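(* Let $X$ and $Y$ be path connected topological spaces, let $G$ be a group acting from the left on $X$ by homeomorphisms, and let $H$ be a finite group with $m$ elements acting from the left on $Y$ by homeomorphisms. Suppose both actions are properly discontinuous, so that the quotient maps $p\colon X\to X/G$ and $q\colon Y\to Y/H$ are regular coverings. Let $\partial_Y\colon \pi_1(Y/H)\to H$ be the boundary homomorphism of the covering map $q$. Then the wreath product $G\wr H$ acts freely (by its natural action) on $W=X^m\times Y$, the corresponding quotient map $r\colon W\to W/(G\wr H)$ is also a regular covering, and there are isomorphisms $$\pi_1\bigl(W/(G\wr H)\bigr)\;\cong\;\pi_1(X/G)\wr_{\partial_Y}\pi_1(Y/H),$$ $$\pi_k\bigl(W/(G\wr H)\bigr)\;\cong\;\pi_k W\;\cong\;(\pi_kX)^m\times\pi_kY,\qquad k\ge 2.$$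
   Context: Properly discontinuous (PD) action: the action of $G$ on $X$ is free and the quotient map $X\to X/G$ (quotient topology) is a covering; equivalently, each $x\in X$ has an open neighborhood $V_x$ with $gV_x\cap hV_x=\varnothing$ for all $g\neq h$ in $G$. For a set $S$ and a group $G$, $\mathrm{Map}(S,G)$ is the group of all maps $S\to G$ under pointwise multiplication. For a group $\mathsf X$ and $h\in \mathsf X$ let $R_h\colon \mathsf X\to \mathsf X$, $R_h(k)=kh$. Wreath product of a homomorphism: for groups $G,K,\mathsf X$ and a homomorphism $\delta\colon K\to \mathsf X$, the group $G\wr_\delta K$ is the set $\mathrm{Map}(\mathsf X,G)\times K$ with multiplication $(\alpha,k)(\beta,l)=(\alpha\cdot(\beta\circ R_{\delta(k)}),\,kl)$, i.e. the first component sends $u\in \mathsf X$ to $\alpha(u)\,\beta(u\,\delta(k))$. The regular wreath product is $G\wr H:=G\wr_{\mathrm{id}_H}H$. Natural action: identify $X^m$ with the space $\mathrm{Map}(H,X)$ of all maps $H\to X$ (by enumerating $H$; product topology). Then $G\wr H$ acts from the left on $W=\mathrm{Map}(H,X)\times Y$ by $(\phi,h)\bullet(\alpha,y)=(\phi\cdot(\alpha\circ R_h),\,hy)$, where $(\phi\cdot(\alpha\circ R_h))(k)=\phi(k)\,\alpha(kh)$ for $k\in H$. Boundary homomorphism: fix $y\in Y$ and take $q(y)$ as base point of $Y/H$. Then $\partial_Y([\gamma])$ is the unique $h\in H$ such that the lift of the loop $\gamma$ starting at $y$ ends at $hy$. Product in $\pi_1$ is concatenation with the first factor traversed first. *)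

(* Defs.v *)
From HB Require Import structures.
From mathcomp Require Import all_boot all_order all_algebra all_fingroup.
From mathcomp Require Import generic_quotient ring lra.
From mathcomp Require Import all_classical all_reals topology normedtype.

Set Implicit Arguments.
Unset Strict Implicit.
Unset Printing Implicit Defensive.

Import Order.TTheory GRing.Theory Num.Theory.
Import numFieldNormedType.Exports.

Local Open Scope classical_set_scope.
Local Open Scope ring_scope.

Lemma withinP (Z T : topologicalType) (A : set Z) (f : Z -> T) :
  {within A, continuous f} <->
  forall x, A x -> forall W, nbhs (f x) W -> \forall z \near x, A z -> W (f z).
Proof.
rewrite /from_subspace subspace_continuousP; split.
- by move=> cf x Ax W Wf; exact: (cf x Ax W Wf).
- by move=> cf x Ax W Wf; exact: (cf x Ax W Wf).
Qed.

Lemma within_comp (Z V T : topologicalType) (A : set Z) (B : set V)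
    (k : Z -> V) (f : V -> T) :
  continuous k -> (forall z, A z -> B (k z)) -> {within B, continuous f} ->
  {within A, continuous (f \o k)}.
Proof.
move=> ck kAB /withinP cf; apply/withinP => x Ax W Wf.
have h : \forall z \near x, B (k z) -> W (f (k z)).
  exact: ck x _ (cf (k x) (kAB x Ax) W Wf).
by apply: filterS h => z h Az; exact/h/kAB.
Qed.

Lemma within_eq (Z T : topologicalType) (A : set Z) (f g : Z -> T) :
  (forall z, A z -> f z = g z) ->
  {within A, continuous f} -> {within A, continuous g}.
Proof.
by move=> fg; apply: subspace_eq_continuous => z /set_mem; exact: fg.
Qed.

Lemma within_if (R : realType) (Z T : topologicalType) (A : set Z)
    (u : Z -> R) (c : R) (f g : Z -> T) :
  continuous u ->
  {within A `&` [set z | u z <= c], continuous f} ->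
  {within A `&` [set z | c <= u z], continuous g} ->
  (forall z, A z -> u z = c -> f z = g z) ->
  {within A, continuous (fun z => if u z <= c then f z else g z)}.
Proof.
move=> cu /withinP cf /withinP cg fg; apply/withinP => x Ax W.
case: (ltrgtP (u x) c) => [ux|ux|ux] WW.
- have hf := cf x (conj Ax (ltW ux)) W WW.
  have hu : \forall z \near x, u z < c.
    by exact: cu x _ (lt_nbhsl ux).
  apply: filterS2 hf hu => z hz uz Az.
  by rewrite (ltW uz); apply: hz; split => //; exact: ltW.
- have hg := cg x (conj Ax (ltW ux)) W WW.
  have hu : \forall z \near x, c < u z.
    by exact: cu x _ (lt_nbhsr ux).
  apply: filterS2 hg hu => z hz uz Az.
  by rewrite leNgt uz /=; apply: hz; split => //; exact: ltW.
- have hf : \forall z \near x, (A `&` [set z | u z <= c]) z -> W (f z).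
    by apply: cf WW; split => //=; rewrite ux.
  have hg : \forall z \near x, (A `&` [set z | c <= u z]) z -> W (g z).
    by apply: cg; [split => //=; rewrite ux | rewrite -(fg x Ax ux)].
  apply: filterS2 hf hg => z hfz hgz Az.
  case: ifPn => uz; first exact: hfz.
  by apply: hgz; split => //=; rewrite ltW // ltNge.
Qed.

Lemma pair_continuous (Z U V : topologicalType) (f : Z -> U) (g : Z -> V) :
  continuous f -> continuous g -> continuous (fun z => (f z, g z) : U * V).
Proof. by move=> cf cg z; apply: cvg_pair; [exact: cf | exact: cg]. Qed.

Lemma fst_continuous (U V : topologicalType) : continuous (@fst U V).
Proof. by move=> z; exact: cvg_fst. Qed.

Lemma snd_continuous (U V : topologicalType) : continuous (@snd U V).
Proof. by move=> z; exact: cvg_snd. Qed.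

Lemma onem_continuous (R : realType) (Z : topologicalType) (u : Z -> R) :
  continuous u -> continuous (fun z => 1 - u z).
Proof. by move=> cu z; apply: cvgB; [exact: cvg_cst | exact: cu]. Qed.

Lemma row_continuous (Z T : topologicalType) n (k : Z -> 'rV[T]_n) :
  (forall i, continuous (fun z => k z ord0 i)) -> continuous k.
Proof.
move=> ck x W [P kP PW].
have : \forall z \near x, forall i : 'I_n, P ord0 i (k z ord0 i).
  by apply: filter_forall => i; exact: ck i x _ (kP ord0 i).
apply: filterS => z hz; apply: PW => i j; rewrite (ord1 i); exact: hz.
Qed.

Section homotopy_groups.
Context {R : realType}.

Definition unit_interval : set R := [set s | 0 <= s <= 1].

Definition cube n : set 'rV[R]_n :=
  [set t | forall i, unit_interval (t ord0 i)].

Definition cube_boundary n : set 'rV[R]_n :=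
  [set t | cube t /\ exists i, t ord0 i = 0 \/ t ord0 i = 1].

Definition path_connected (T : topologicalType) :=
  forall a b : T, exists c : R -> T,
    [/\ {within unit_interval, continuous c}, c 0 = a & c 1 = b].

Section fixed_space.
Context {T : topologicalType}.

(* Maps (I^n, dI^n) -> (T, x); only the values on the cube are relevant. *)
Record based_map n (x : T) := BasedMap {
  based_fun :> 'rV[R]_n -> T;
  based_continuous : {within @cube n, continuous based_fun};
  based_boundary : forall t, cube_boundary t -> based_fun t = x
}.

Arguments based_continuous {n x} b.

HB.instance Definition _ n x := gen_eqMixin (based_map n x).
HB.instance Definition _ n x := gen_choiceMixin (based_map n x).

Definition homotopic n x (f g : based_map n x) :=
  exists F : R * 'rV[R]_n -> T,
    [/\ {within unit_interval `*` @cube n, continuous F},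
        forall t, cube t -> F (0, t) = f t,
        forall t, cube t -> F (1, t) = g t &
        forall s t, unit_interval s -> cube_boundary t -> F (s, t) = x].

Lemma unit_interval0 : unit_interval 0.
Proof. by rewrite /unit_interval /=; lra. Qed.

Lemma unit_interval1 : unit_interval 1.
Proof. by rewrite /unit_interval /=; lra. Qed.

Lemma homotopic_eq n x (f g : based_map n x) :
  (forall t, cube t -> f t = g t) -> homotopic f g.
Proof.
move=> fg; exists (fun z => f z.2); split => //=.
- apply: (within_comp (k := snd) _ _ (based_continuous f)); last by move=> z [].
  exact: snd_continuous.
- by move=> s t _; exact: based_boundary.
Qed.

Lemma homotopic_refl n x (f : based_map n x) : homotopic f f.
Proof. exact: homotopic_eq. Qed.

Lemma homotopic_sym n x (f g : based_map n x) : homotopic f g -> homotopic g f.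
Proof.
move=> [F [cF F0 F1 Fb]]; exists (fun z => F (1 - z.1, z.2)); split => /=.
- apply: (within_comp (k := fun z : R * 'rV[R]_n => (1 - z.1, z.2) : R * 'rV[R]_n) _ _ cF).
  + apply: pair_continuous; last exact: snd_continuous.
    by move=> z; apply: cvgB; [exact: cvg_cst | exact: fst_continuous].
  + by move=> z [] /= z1 z2; split => //=; move: z1; rewrite /unit_interval/=; lra.
- by move=> t ct; rewrite subr0 F1.
- by move=> t ct; rewrite subrr F0.
- by move=> s t s01 bt; apply: Fb => //; move: s01; rewrite /unit_interval/=; lra.
Qed.

Lemma homotopic_trans n x (f g h : based_map n x) :
  homotopic f g -> homotopic g h -> homotopic f h.
Proof.
move=> [F [cF F0 F1 Fb]] [K [cK K0 K1 Kb]].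
exists (fun z => if z.1 <= 2^-1 then F (2 * z.1, z.2) else K (2 * z.1 - 1, z.2)).
have c1 : continuous (fun z : R * 'rV[R]_n => 2 * z.1).
  by move=> z; apply: cvgM; [exact: cvg_cst | exact: fst_continuous].
split => /=.
- apply: within_if.
  + by move=> z; exact: fst_continuous.
  + apply: (within_comp (k := fun z : R * 'rV[R]_n => (2 * z.1, z.2) : R * 'rV[R]_n) _ _ cF).
      by apply: pair_continuous; [exact: c1 | exact: snd_continuous].
    by move=> z [[/= z1 z2] z3]; split => //=; move: z1 z3;
       rewrite /unit_interval/=; lra.
  + apply: (within_comp (k := fun z : R * 'rV[R]_n => (2 * z.1 - 1, z.2) : R * 'rV[R]_n) _ _ cK).
      apply: pair_continuous; last exact: snd_continuous.
      by move=> z; apply: cvgB; [exact: c1 | exact: cvg_cst].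
    by move=> z [[/= z1 z2] z3]; split => //=; move: z1 z3;
       rewrite /unit_interval/=; lra.
  + move=> [s t] [/= _ ct] ->; rewrite mulfV ?pnatr_eq0 // subrr.
    by rewrite F1 // K0.
- by move=> t ct; rewrite mulr0 invr_ge0 ler0n F0.
- move=> t ct; rewrite ifF; last by apply/negbTE; lra.
  by rewrite mulr1 (_ : 2 - 1 = 1) ?K1 //; lra.
- move=> s t s01 bt; case: ifPn => hs; [apply: Fb | apply: Kb] => //;
  by move: s01 hs; rewrite /unit_interval/=; lra.
Qed.

Definition homotopicb n x (f g : based_map n x) : bool := `[< homotopic f g >].

Lemma homotopicb_refl n x : reflexive (@homotopicb n x).
Proof. by move=> f; apply/asboolP; exact: homotopic_refl. Qed.

Lemma homotopicb_sym n x : symmetric (@homotopicb n x).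
Proof.
by move=> f g; apply/asboolP/asboolP; exact: homotopic_sym.
Qed.

Lemma homotopicb_trans n x : transitive (@homotopicb n x).
Proof.
move=> g f h /asboolP fg /asboolP gh; apply/asboolP.
exact: homotopic_trans gh.
Qed.

Definition homotopy_equiv n x :=
  EquivRel (@homotopicb n x) (@homotopicb_refl n x) (@homotopicb_sym n x)
    (@homotopicb_trans n x).

Definition homotopy_group n (x : T) : Type := {eq_quot (homotopy_equiv n x)}%qT.

HB.instance Definition _ n x := Choice.on (homotopy_group n x).
HB.instance Definition _ n x := EqQuotient.on (homotopy_group n x).

Definition homotopy_class n x (f : based_map n x) : homotopy_group n x :=
  \pi_(homotopy_group n x)%qT f.

Lemma homotopy_classP n x (f g : based_map n x) :
  homotopy_class f = homotopy_class g <-> homotopic f g.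
Proof.
split=> [/eqquotP/asboolP //|fg]; apply/eqquotP; exact/asboolP.
Qed.

Lemma homotopy_class_surj n x (a : homotopy_group n x) :
  exists f, a = homotopy_class f.
Proof. by exists (repr a); rewrite /homotopy_class reprK. Qed.

(* [set_first t s] is t with its first coordinate replaced by s. *)
Definition set_first n (t : 'rV[R]_n.+1) (s : R) : 'rV[R]_n.+1 :=
  \row_i (if i == ord0 then s else t ord0 i).

Lemma set_first0 n (t : 'rV[R]_n.+1) s : set_first t s ord0 ord0 = s.
Proof. by rewrite mxE eqxx. Qed.

Lemma set_firstS n (t : 'rV[R]_n.+1) s i :
  i != ord0 -> set_first t s ord0 i = t ord0 i.
Proof. by move=> /negbTE i0; rewrite mxE i0. Qed.

Lemma set_first_set_first n (t : 'rV[R]_n.+1) s s' :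
  set_first (set_first t s) s' = set_first t s'.
Proof. by apply/rowP => i; rewrite !mxE; case: eqP. Qed.

Lemma set_first_id n (t : 'rV[R]_n.+1) : set_first t (t ord0 ord0) = t.
Proof. by apply/rowP => i; rewrite !mxE; case: eqP => // ->. Qed.

Lemma set_first_cube n (t : 'rV[R]_n.+1) s :
  cube t -> unit_interval s -> cube (set_first t s).
Proof. by move=> ct s01 i; rewrite mxE; case: ifP. Qed.

Lemma set_first_boundary n (t : 'rV[R]_n.+1) s :
  cube_boundary t -> unit_interval s ->
  (t ord0 ord0 = 0 \/ t ord0 ord0 = 1 -> s = 0 \/ s = 1) ->
  cube_boundary (set_first t s).
Proof.
move=> [ct [i ti]] s01 st; split; first exact: set_first_cube.
have [i0|i0] := eqVneq i ord0.
  by exists ord0; rewrite set_first0; apply: st; rewrite -i0.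
by exists i; rewrite set_firstS.
Qed.

Lemma set_first_end n (t : 'rV[R]_n.+1) s :
  cube t -> s = 0 \/ s = 1 -> cube_boundary (set_first t s).
Proof.
move=> ct s01; split; last by exists ord0; rewrite set_first0.
by apply: set_first_cube => //; case: s01 => ->;
  [exact: unit_interval0 | exact: unit_interval1].
Qed.

Lemma set_first_continuous (Z : topologicalType) n (k : Z -> 'rV[R]_n.+1)
    (v : Z -> R) :
  continuous k -> continuous v -> continuous (fun z => set_first (k z) (v z)).
Proof.
move=> ck cv; apply: row_continuous => i.
have [->|i0] := eqVneq i ord0.
  rewrite (_ : (fun _ => _) = v) //.
  by apply/funext => z; rewrite set_first0.
rewrite (_ : (fun _ => _) = (fun z => k z ord0 i)); last first.
  by apply/funext => z; rewrite set_firstS.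
move=> z; apply: (@continuous_comp _ _ _ k (fun t : 'rV[R]_n.+1 => t ord0 i)).
  exact: ck.
exact: coord_continuous.
Qed.

Lemma first_continuous n : continuous (fun t : 'rV[R]_n.+1 => t ord0 ord0).
Proof. exact: coord_continuous. Qed.

(* Concatenation in the first coordinate, the first factor being traversed
   first. *)
Definition concat_fun n (f g : 'rV[R]_n.+1 -> T) (t : 'rV[R]_n.+1) : T :=
  if t ord0 ord0 <= 2^-1 then f (set_first t (2 * t ord0 ord0))
  else g (set_first t (2 * t ord0 ord0 - 1)).

Lemma concat_within (Z : topologicalType) n (x : T) (A : set Z)
    (k : Z -> 'rV[R]_n.+1) (F G : Z * 'rV[R]_n.+1 -> T) :
  continuous k -> (forall z, A z -> cube (k z)) ->
  {within A `*` @cube n.+1, continuous F} ->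
  {within A `*` @cube n.+1, continuous G} ->
  (forall z t, A z -> cube_boundary t -> F (z, t) = x) ->
  (forall z t, A z -> cube_boundary t -> G (z, t) = x) ->
  {within A, continuous
    (fun z => concat_fun (fun t => F (z, t)) (fun t => G (z, t)) (k z))}.
Proof.
move=> ck kA cF cG Fx Gx.
have ck0 : continuous (fun z => k z ord0 ord0).
  move=> z; apply: (@continuous_comp _ _ _ k (fun t => t ord0 ord0)).
    exact: ck.
  exact: first_continuous.
have c2 : continuous (fun z => 2 * k z ord0 ord0).
  by move=> z; apply: cvgM; [exact: cvg_cst | exact: ck0].
apply: within_if => //.
- apply: (within_comp (k := fun z =>
    (z, set_first (k z) (2 * k z ord0 ord0)) : Z * 'rV[R]_n.+1)
           _ _ cF).
    apply: pair_continuous; first by move=> z; exact: cvg_id.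
    exact: (set_first_continuous ck c2).
  move=> z [Az z0]; split => //=; apply: set_first_cube; first exact: kA.
  have := kA z Az ord0; move: z0; rewrite /unit_interval/=; lra.
- apply: (within_comp
      (k := fun z =>
    (z, set_first (k z) (2 * k z ord0 ord0 - 1)) : Z * 'rV[R]_n.+1) _ _ cG).
    apply: pair_continuous; first by move=> z; exact: cvg_id.
    apply: (set_first_continuous (v := fun z => 2 * k z ord0 ord0 - 1) ck).
    by move=> {}z; apply: cvgB; [exact: c2 | exact: cvg_cst].
  move=> z [Az z0]; split => //=; apply: set_first_cube; first exact: kA.
  have := kA z Az ord0; move: z0; rewrite /unit_interval/=; lra.
- move=> z Az ->; rewrite mulfV ?pnatr_eq0 // subrr.
  by rewrite Fx ?Gx //; apply: set_first_end; (try exact: kA); by [left | right].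
Qed.

Lemma concat_boundary n (x : T) (f g : 'rV[R]_n.+1 -> T) t :
  (forall t, cube_boundary t -> f t = x) ->
  (forall t, cube_boundary t -> g t = x) ->
  cube_boundary t -> concat_fun f g t = x.
Proof.
move=> fx gx bt; have := bt.1 ord0; rewrite /concat_fun /unit_interval /=.
by case: ifPn => t0 t01; [apply: fx | apply: gx];
  apply: set_first_boundary => //=; rewrite /unit_interval/=; lra.
Qed.

Lemma concat_continuous n x (f g : based_map n.+1 x) :
  {within @cube n.+1, continuous (concat_fun f g)}.
Proof.
have csnd : continuous (@snd 'rV[R]_n.+1 'rV[R]_n.+1).
  exact: snd_continuous.
apply: (@concat_within _ n x _ id (fun z => f z.2) (fun z => g z.2)).
- by move=> z; exact: cvg_id.
- by [].
- by apply: (within_comp (k := snd) csnd _ (based_continuous f)) => z [].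
- by apply: (within_comp (k := snd) csnd _ (based_continuous g)) => z [].
- by move=> z t _; exact: based_boundary.
- by move=> z t _; exact: based_boundary.
Qed.

Definition concat n x (f g : based_map n.+1 x) : based_map n.+1 x :=
  BasedMap (@concat_continuous n x f g)
    (fun t => @concat_boundary n x f g t (based_boundary f) (based_boundary g)).

Lemma concat_homotopic n x (f f' g g' : based_map n.+1 x) :
  homotopic f f' -> homotopic g g' -> homotopic (concat f g) (concat f' g').
Proof.
move=> [F [cF F0 F1 Fb]] [K [cK K0 K1 Kb]].
exists (fun z => concat_fun (fun t => F (z.1, t)) (fun t => K (z.1, t)) z.2).
have ck : continuous (fun z : (R * 'rV[R]_n.+1) * 'rV[R]_n.+1 =>
    (z.1.1, z.2) : R * 'rV[R]_n.+1).
  apply: pair_continuous; last exact: snd_continuous.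
  by move=> z; apply: (@continuous_comp _ _ _ fst fst); exact: fst_continuous.
split.
- apply: (@concat_within _ n x _ snd (fun z => F (z.1.1, z.2))
    (fun z => K (z.1.1, z.2))).
  + exact: snd_continuous.
  + by move=> z [].
  + by apply: (within_comp ck _ cF) => z [[]].
  + by apply: (within_comp ck _ cK) => z [[]].
  + by move=> z t [z1 _]; exact: Fb.
  + by move=> z t [z1 _]; exact: Kb.
- move=> t ct /=; have := ct ord0; rewrite /concat_fun /unit_interval /=.
  by case: ifPn => t0 t01; [apply: F0 | apply: K0];
    apply: set_first_cube => //; rewrite /unit_interval/=; lra.
- move=> t ct /=; have := ct ord0; rewrite /concat_fun /unit_interval /=.
  by case: ifPn => t0 t01; [apply: F1 | apply: K1];
    apply: set_first_cube => //; rewrite /unit_interval/=; lra.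
- move=> s t s01 bt /=.
  by apply: concat_boundary => // t' bt'; [exact: Fb | exact: Kb].
Qed.

Lemma reverse_continuous n x (f : based_map n.+1 x) :
  {within @cube n.+1, continuous (fun t => f (set_first t (1 - t ord0 ord0)))}.
Proof.
apply: (within_comp (k := fun t : 'rV[R]_n.+1 => set_first t (1 - t ord0 ord0)) _ _
  (based_continuous f)).
  apply: (set_first_continuous (k := id) (v := fun t : 'rV[R]_n.+1 => 1 - t ord0 ord0)).
    by move=> z; exact: cvg_id.
  exact/onem_continuous/first_continuous.
move=> t ct; apply: set_first_cube => //.
by have := ct ord0; rewrite /unit_interval/=; lra.
Qed.

Lemma reverse_boundary n x (f : based_map n.+1 x) t :
  cube_boundary t -> f (set_first t (1 - t ord0 ord0)) = x.
Proof.
move=> bt; apply: based_boundary.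
by apply: set_first_boundary => //;
  move: (bt.1 ord0); rewrite /unit_interval/=; lra.
Qed.

Definition reverse n x (f : based_map n.+1 x) : based_map n.+1 x :=
  BasedMap (@reverse_continuous n x f) (@reverse_boundary n x f).

Lemma reverse_homotopic n x (f g : based_map n.+1 x) :
  homotopic f g -> homotopic (reverse f) (reverse g).
Proof.
move=> [F [cF F0 F1 Fb]].
have ct1 t : @cube n.+1 t -> cube (set_first t (1 - t ord0 ord0)).
  move=> ct; apply: set_first_cube => //.
  by have := ct ord0; rewrite /unit_interval/=; lra.
exists (fun z => F (z.1, set_first z.2 (1 - z.2 ord0 ord0))); split.
- apply: (within_comp
    (k := fun z : R * 'rV[R]_n.+1 =>
      (z.1, set_first z.2 (1 - z.2 ord0 ord0)) : R * 'rV[R]_n.+1) _ _ cF).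
    apply: pair_continuous; first exact: fst_continuous.
    apply: (set_first_continuous (k := snd)
      (v := fun z : R * 'rV[R]_n.+1 => 1 - z.2 ord0 ord0)).
      exact: snd_continuous.
    apply: onem_continuous => {}z.
    apply: (@continuous_comp _ _ _ snd (fun t : 'rV[R]_n.+1 => t ord0 ord0)).
      exact: snd_continuous.
    exact: first_continuous.
  by move=> z [z1 z2]; split => //; exact: ct1.
- by move=> t /ct1 ct; exact: F0.
- by move=> t /ct1 ct; exact: F1.
- move=> s t s01 bt; apply: Fb => //=; apply: set_first_boundary => //;
  by move: (bt.1 ord0); rewrite /unit_interval/=; lra.
Qed.

Lemma constant_continuous n (x : T) :
  {within @cube n, continuous (fun=> x)}.
Proof. by apply: continuous_subspaceT; exact: cst_continuous. Qed.

Definition constant n x : based_map n x :=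
  BasedMap (@constant_continuous n x) (fun t _ => erefl).

Lemma reparametrization_homotopic n x (f g h : based_map n.+1 x)
    (phi psi : R -> R) :
  continuous phi -> continuous psi ->
  (forall s, unit_interval s -> unit_interval (phi s)) ->
  (forall s, unit_interval s -> unit_interval (psi s)) ->
  (phi 0 = psi 0 /\ (phi 0 = 0 \/ phi 0 = 1)) ->
  (phi 1 = psi 1 /\ (phi 1 = 0 \/ phi 1 = 1)) ->
  (forall t, cube t -> g t = f (set_first t (phi (t ord0 ord0)))) ->
  (forall t, cube t -> h t = f (set_first t (psi (t ord0 ord0)))) ->
  homotopic g h.
Proof.
move=> cphi cpsi phi01 psi01 [e0 v0] [e1 v1] gE hE.
pose v (z : R * 'rV[R]_n.+1) :=
  (1 - z.1) * phi (z.2 ord0 ord0) + z.1 * psi (z.2 ord0 ord0).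
have cz0 : continuous (fun z : R * 'rV[R]_n.+1 => z.2 ord0 ord0).
  move=> z.
  apply: (@continuous_comp _ _ _ snd (fun t : 'rV[R]_n.+1 => t ord0 ord0)).
    exact: snd_continuous.
  exact: first_continuous.
have cv : continuous v.
  move=> z; apply: cvgD; apply: cvgM.
  - by apply: cvgB; [exact: cvg_cst | exact: fst_continuous].
  - apply: (@continuous_comp _ _ _ (fun z : R * 'rV[R]_n.+1 => z.2 ord0 ord0)).
      exact: cz0.
    exact: cphi.
  - exact: fst_continuous.
  - apply: (@continuous_comp _ _ _ (fun z : R * 'rV[R]_n.+1 => z.2 ord0 ord0)).
      exact: cz0.
    exact: cpsi.
have v01 z : unit_interval z.1 -> cube z.2 -> unit_interval (v z).
  move=> z1 /(_ ord0) z2; move: (phi01 _ z2) (psi01 _ z2) z1.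
  rewrite /v /unit_interval /= => p q r; apply/andP; split; nra.
exists (fun z => f (set_first z.2 (v z))); split.
- apply: (within_comp (k := fun z : R * 'rV[R]_n.+1 => set_first z.2 (v z)) _ _
    (based_continuous f)).
    apply: (set_first_continuous (k := snd)) => // z; exact: snd_continuous.
  by move=> z [z1 z2]; apply: set_first_cube => //; exact: v01.
- by move=> t ct; rewrite gE // /v /= subr0 mul1r mul0r addr0.
- by move=> t ct; rewrite hE // /v /= subrr mul0r mul1r add0r.
- move=> s t s01 bt; apply: based_boundary; apply: set_first_boundary => //=.
    by apply: v01 => //; exact: bt.1.
  case=> t0; rewrite /v /= t0.
  + by case: v0 => v0; rewrite -e0 v0; [left | right]; ring.
  + by case: v1 => v1; rewrite -e1 v1; [left | right]; ring.
Qed.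

Section group_laws.
Context {n : nat} {x : T}.
Implicit Types (f g h : based_map n.+1 x) (a b c : homotopy_group n.+1 x).

Definition homotopy_mul a b : homotopy_group n.+1 x :=
  homotopy_class (concat (repr a) (repr b)).

Definition homotopy_one : homotopy_group n.+1 x :=
  homotopy_class (constant n.+1 x).

Definition homotopy_inv a : homotopy_group n.+1 x :=
  homotopy_class (reverse (repr a)).

Lemma repr_homotopic f : homotopic (repr (homotopy_class f)) f.
Proof. by apply/homotopy_classP; rewrite /homotopy_class reprK. Qed.

Lemma homotopy_mulE f g :
  homotopy_mul (homotopy_class f) (homotopy_class g) =
  homotopy_class (concat f g).
Proof.
by apply/homotopy_classP; apply: concat_homotopic; exact: repr_homotopic.
Qed.

Lemma homotopy_invE f :
  homotopy_inv (homotopy_class f) = homotopy_class (reverse f).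
Proof.
by apply/homotopy_classP; apply: reverse_homotopic; exact: repr_homotopic.
Qed.

Lemma affine_continuous (p q : R) : continuous (fun s : R => p * s + q).
Proof.
by move=> s; apply: cvgD; [apply: cvgM; [exact: cvg_cst | exact: cvg_id] |
  exact: cvg_cst].
Qed.

Lemma min_continuous (u v : R -> R) :
  continuous u -> continuous v -> continuous (fun s => Num.min (u s) (v s)).
Proof. by move=> cu cv s; apply: continuous_min; [exact: cu | exact: cv]. Qed.

Lemma max_continuous (u v : R -> R) :
  continuous u -> continuous v -> continuous (fun s => Num.max (u s) (v s)).
Proof. by move=> cu cv s; apply: continuous_max; [exact: cu | exact: cv]. Qed.

Lemma concat_assoc f g h :
  homotopic (concat f (concat g h)) (concat (concat f g) h).
Proof.
pose phi s : R := Num.min (2 * s + 0) (Num.min (1 * s + 4^-1) (2^-1 * s + 2^-1)).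
apply: (@reparametrization_homotopic n x (concat f (concat g h)) _ _ id phi).
- by move=> s; exact: cvg_id.
- by repeat (apply: min_continuous; first exact: affine_continuous);
    exact: affine_continuous.
- by [].
- move=> s; rewrite /phi /unit_interval /= /Num.min; do 2!case: ifP; lra.
- rewrite /phi /Num.min; do 2!case: ifP; lra.
- rewrite /phi /Num.min; do 2!case: ifP; lra.
- by move=> t _; rewrite set_first_id.
- move=> t /(_ ord0); rewrite /unit_interval /= /concat_fun.
  set s := t ord0 ord0 => s01.
  rewrite !(set_first0, set_first_set_first) /phi /Num.min.
  repeat case: ifP; move=> *; try (exfalso; lra).
  all: match goal with |- ?k (set_first _ ?u) = ?k (set_first _ ?v) =>
    by rewrite (_ : u = v) //; lra end.
Qed.

Lemma concat_constantl f : homotopic (concat (constant n.+1 x) f) f.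
Proof.
pose phi s : R := Num.max (0 * s + 0) (2 * s - 1).
apply: (@reparametrization_homotopic n x f _ _ phi id).
- by apply: max_continuous; exact: affine_continuous.
- by move=> s; exact: cvg_id.
- move=> s; rewrite /phi /unit_interval /= /Num.max; case: ifP; lra.
- by [].
- rewrite /phi /Num.max; case: ifP; lra.
- rewrite /phi /Num.max; case: ifP; lra.
- move=> t ct; have := ct ord0; rewrite /unit_interval /= /concat_fun /=.
  set s := t ord0 ord0 => s01; rewrite /phi /Num.max.
  case: ifP => s2; case: ifP => s3; try (exfalso; lra).
  + by rewrite based_boundary //; apply: set_first_end => //; left; lra.
  + by congr (f (set_first t _)); lra.
- by move=> t _; rewrite set_first_id.
Qed.

Lemma concat_constantr f : homotopic (concat f (constant n.+1 x)) f.
Proof.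
pose phi s : R := Num.min (2 * s + 0) (0 * s + 1).
apply: (@reparametrization_homotopic n x f _ _ phi id).
- by apply: min_continuous; exact: affine_continuous.
- by move=> s; exact: cvg_id.
- move=> s; rewrite /phi /unit_interval /= /Num.min; case: ifP; lra.
- by [].
- rewrite /phi /Num.min; case: ifP; lra.
- rewrite /phi /Num.min; case: ifP; lra.
- move=> t ct; have := ct ord0; rewrite /unit_interval /= /concat_fun /=.
  set s := t ord0 ord0 => s01; rewrite /phi /Num.min.
  case: ifP => s2; case: ifP => s3; try (exfalso; lra).
  + by congr (f (set_first t _)); lra.
  + by congr (f (set_first t _)); lra.
  + by rewrite based_boundary //; apply: set_first_end => //; right; lra.
- by move=> t _; rewrite set_first_id.
Qed.

Lemma concat_reverser f : homotopic (concat f (reverse f)) (constant n.+1 x).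
Proof.
pose phi s : R := Num.min (2 * s + 0) ((- 2) * s + 2).
apply: (@reparametrization_homotopic n x f _ _ phi (fun=> 0)).
- by apply: min_continuous; exact: affine_continuous.
- exact: cst_continuous.
- move=> s; rewrite /phi /unit_interval /= /Num.min; case: ifP; lra.
- by move=> s _; exact: unit_interval0.
- rewrite /phi /Num.min; case: ifP; lra.
- rewrite /phi /Num.min; case: ifP; lra.
- move=> t ct; have := ct ord0; rewrite /unit_interval /= /concat_fun /=.
  set s := t ord0 ord0 => s01.
  rewrite !(set_first0, set_first_set_first) /phi /Num.min.
  case: ifP => s2; case: ifP => s3; try (exfalso; lra);
  by congr (f (set_first t _)); lra.
- move=> t ct /=; rewrite based_boundary //.
  by apply: set_first_end => //; left.
Qed.

Lemma reverse_reverse f : homotopic (reverse (reverse f)) f.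
Proof.
apply: homotopic_eq => t _ /=.
rewrite !(set_first0, set_first_set_first) opprB addrC subrK.
by rewrite set_first_id.
Qed.

Lemma homotopy_mulA : associative homotopy_mul.
Proof.
move=> a b c.
have [f ->] := homotopy_class_surj a; have [g ->] := homotopy_class_surj b.
have [h ->] := homotopy_class_surj c.
by rewrite !homotopy_mulE; apply/homotopy_classP; exact: concat_assoc.
Qed.

Lemma homotopy_mul1g : left_id homotopy_one homotopy_mul.
Proof.
move=> a; have [f ->] := homotopy_class_surj a.
by rewrite homotopy_mulE; apply/homotopy_classP; exact: concat_constantl.
Qed.

Lemma homotopy_mulg1 : right_id homotopy_one homotopy_mul.
Proof.
move=> a; have [f ->] := homotopy_class_surj a.
by rewrite homotopy_mulE; apply/homotopy_classP; exact: concat_constantr.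
Qed.

Lemma homotopy_mulgV : right_inverse homotopy_one homotopy_inv homotopy_mul.
Proof.
move=> a; have [f ->] := homotopy_class_surj a.
rewrite homotopy_invE homotopy_mulE.
by apply/homotopy_classP; exact: concat_reverser.
Qed.

Lemma homotopy_invK : involutive homotopy_inv.
Proof.
move=> a; have [f ->] := homotopy_class_surj a.
by rewrite !homotopy_invE; apply/homotopy_classP; exact: reverse_reverse.
Qed.

Lemma homotopy_mulVg : left_inverse homotopy_one homotopy_inv homotopy_mul.
Proof. by move=> a; rewrite -{2}(homotopy_invK a) homotopy_mulgV. Qed.

HB.instance Definition _ := isGroup.Build (homotopy_group n.+1 x)
  homotopy_mulA homotopy_mul1g homotopy_mulg1 homotopy_mulVg homotopy_mulgV.

End group_laws.
End fixed_space.
End homotopy_groups.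

Arguments path_connected R T : clear implicits.
Arguments cube {R} n.
Arguments based_map R {T} n x.
Arguments homotopy_group R {T} n x.

Definition group_isomorphic (G K : groupType) :=
  exists f : UMagmaMorphism.type G K, bijective f.

(* Carrier Map(L, G) x K, with (a, k)(b, l) = (a . (b \o R_(delta k)), kl). *)
Definition wreath_product (G K L : groupType)
  (delta : UMagmaMorphism.type K L) : Type := ((L -> G) * K)%type.

Section wreath_product.
Context {G K L : groupType} {delta : UMagmaMorphism.type K L}.

Local Notation W := (@wreath_product G K L delta).
Implicit Types v w : W.

HB.instance Definition _ := Choice.copy W ((L -> G) * K)%type.

Definition wreath_mul v w : W :=
  ((fun u => v.1 u * w.1 (u * delta v.2))%g, (v.2 * w.2)%g).

Definition wreath_one : W := (fun=> 1%g, 1%g).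

Definition wreath_inv v : W :=
  ((fun u => (v.1 (u * delta v.2^-1))^-1)%g, (v.2^-1)%g).

Lemma wreath_mulA : associative wreath_mul.
Proof.
move=> v w z; congr (_, _); last exact: mulgA.
by apply/funext => u /=; rewrite gmulfM !mulgA.
Qed.

Lemma wreath_mul1g : left_id wreath_one wreath_mul.
Proof.
move=> [a k]; congr (_, _); last exact: mul1g.
by apply/funext => u /=; rewrite gmulf1 mulg1 mul1g.
Qed.

Lemma wreath_mulg1 : right_id wreath_one wreath_mul.
Proof.
move=> [a k]; congr (_, _); last exact: mulg1.
by apply/funext => u /=; rewrite mulg1.
Qed.

Lemma wreath_mulVg : left_inverse wreath_one wreath_inv wreath_mul.
Proof.
move=> [a k]; congr (_, _); last exact: mulVg.
by apply/funext => u /=; rewrite mulVg.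
Qed.

Lemma wreath_mulgV : right_inverse wreath_one wreath_inv wreath_mul.
Proof.
move=> [a k]; congr (_, _); last exact: mulgV.
by apply/funext => u /=; rewrite -mulgA -gmulfM mulgV gmulf1 mulg1 mulgV.
Qed.

HB.instance Definition _ := isGroup.Build W
  wreath_mulA wreath_mul1g wreath_mulg1 wreath_mulVg wreath_mulgV.

End wreath_product.

Arguments wreath_product G {K L} delta.

Notation regular_wreath_product G H :=
  (wreath_product G (idfun : UMagmaMorphism.type H H)).

Section coverings.
Context {E B : topologicalType}.
Implicit Types p : E -> B.

Definition homeomorphism_between (V : set E) (U : set B) p :=
  exists s : B -> E,
    [/\ {within V, continuous p}, {within U, continuous s},
        (forall e, V e -> U (p e) /\ s (p e) = e) &
        (forall b, U b -> V (s b) /\ p (s b) = b)].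

Definition evenly_covered p (U : set B) :=
  exists (I : Type) (V : I -> set E),
    [/\ forall i, open (V i), trivIset setT V, p @^-1` U = \bigcup_i V i &
        forall i, homeomorphism_between (V i) U p].

Definition covering p :=
  [/\ continuous p, (forall b, exists e, p e = b) &
      forall b, exists U : set B, [/\ open U, U b & evenly_covered p U]].

Definition deck_transformation p (f : E -> E) :=
  [/\ continuous f, exists g, [/\ continuous g, cancel f g & cancel g f] &
      forall e, p (f e) = p e].

(* Regular: the deck transformations act transitively on the fibres. *)
Definition regular_covering p :=
  covering p /\
  forall e e', p e = p e' -> exists2 f, deck_transformation p f & f e = e'.

End coverings.

(* Each [lact g] is a homeomorphism, with inverse [lact g^-1]. *)
Record left_action (G : groupType) (T : topologicalType) := LeftAction {
  lact :> G -> T -> T;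
  lact1 : forall t, lact 1%g t = t;
  lactM : forall g h t, lact (g * h)%g t = lact g (lact h t);
  lact_continuous : forall g, continuous (lact g)
}.

Section orbit_spaces.
Context {G : groupType} {T : topologicalType} (a : left_action G T).

Definition same_orbit : rel T := fun s t => `[< exists g, a g s = t >].

Lemma same_orbit_refl : reflexive same_orbit.
Proof. by move=> t; apply/asboolP; exists 1%g; rewrite lact1. Qed.

Lemma same_orbit_sym : symmetric same_orbit.
Proof.
have h s t : (exists g, a g s = t) -> exists g, a g t = s.
  by move=> [g <-]; exists (g^-1)%g; rewrite -lactM mulVg lact1.
by move=> s t; apply/asboolP/asboolP; exact: h.
Qed.

Lemma same_orbit_trans : transitive same_orbit.
Proof.
move=> t s u /asboolP[g <-] /asboolP[h <-]; apply/asboolP.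
by exists (h * g)%g; rewrite lactM.
Qed.

Definition orbit_equiv :=
  EquivRel same_orbit same_orbit_refl same_orbit_sym same_orbit_trans.

Definition orbit_space : Type := quotient_topology {eq_quot orbit_equiv}%qT.

HB.instance Definition _ := Topological.on orbit_space.

Definition orbit_map (t : T) : orbit_space :=
  (\pi_(quotient_topology {eq_quot orbit_equiv}) t)%qT.

Definition free_action := forall g t, a g t = t -> g = 1%g.

Definition properly_discontinuous := free_action /\ covering orbit_map.

End orbit_spaces.

Definition is_lift (R : realType) (E B : topologicalType) (p : E -> B)
    (gamma : 'rV[R]_1 -> B) (l : 'rV[R]_1 -> E) :=
  {within cube 1, continuous l} /\ forall t, cube 1 t -> p (l t) = gamma t.

(* For a free action, [d [gamma]] is the unique [h] such that the lift of
   [gamma] starting at [y] ends at [a h y]. *)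
Definition is_boundary (R : realType) (H : groupType) (Y : topologicalType)
    (a : left_action H Y) (y : Y)
    (d : homotopy_group R 1 (orbit_map a y) -> H) :=
  forall gamma : based_map R 1 (orbit_map a y),
    (exists l, is_lift (orbit_map a) gamma l /\ l (const_mx 0) = y) /\
    (forall l, is_lift (orbit_map a) gamma l -> l (const_mx 0) = y ->
      l (const_mx 1) = a (d (homotopy_class gamma)) y).

Lemma ptws_continuous (Z : topologicalType) (I : Type) (T : topologicalType)
    (f : Z -> {ptws I -> T}) :
  (forall i, continuous (fun z => f z i)) -> continuous f.
Proof.
move=> cf z; apply/cvg_sup => i U [_ [[V oV <-] Vz VU]].
have : \forall w \near z, V (f w i) by exact: cf i z _ (open_nbhs_nbhs (conj oV Vz)).
by apply: filterS => w Vw; exact: VU.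
Qed.

Lemma ptws_eval_continuous (I : eqType) (T : topologicalType) (i : I) :
  continuous (fun f : {ptws I -> T} => f i).
Proof. exact: (@proj_continuous I (fun=> T) i). Qed.

Section natural_action.
Context {G H : groupType} {X Y : topologicalType}.
Variables (aG : left_action G X) (aH : left_action H Y).

(* X^m x Y, with X^m identified with the maps H -> X. *)
Definition wreath_space : Type := ({ptws H -> X} * Y)%type.

HB.instance Definition _ := Topological.on wreath_space.

Definition wreath_act (v : regular_wreath_product G H) (w : wreath_space) :
    wreath_space :=
  ((fun k => aG (v.1 k) (w.1 (k * v.2)%g)), aH v.2 w.2).

Lemma wreath_act1 w : wreath_act 1%g w = w.
Proof.
case: w => f y; congr (_, _); last exact: lact1.
by apply/funext => k /=; rewrite lact1 mulg1.
Qed.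

Lemma wreath_actM u v w :
  wreath_act (u * v)%g w = wreath_act u (wreath_act v w).
Proof.
congr (_, _); last exact: lactM.
by apply/funext => k /=; rewrite lactM mulgA.
Qed.

Lemma wreath_act_continuous v : continuous (wreath_act v).
Proof.
apply: pair_continuous.
  apply: ptws_continuous => k w.
  apply: (@continuous_comp _ _ _ (fun w : wreath_space => w.1 (k * v.2)%g)).
    apply: (@continuous_comp _ _ _ fst (fun f : {ptws H -> X} => f (k * v.2)%g)).
      exact: fst_continuous.
    exact: ptws_eval_continuous.
  exact: lact_continuous.
move=> w; apply: (@continuous_comp _ _ _ snd); first exact: snd_continuous.
exact: lact_continuous.
Qed.

Definition wreath_action : left_action (regular_wreath_product G H) wreath_space :=
  LeftAction wreath_act1 wreath_actM wreath_act_continuous.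

End natural_action.

Arguments wreath_space H X Y : clear implicits.

(* Main.v *)
Require Import Defs.
From HB Require Import structures.
From mathcomp Require Import all_boot all_order all_algebra all_fingroup.
From mathcomp Require Import generic_quotient ring lra.
From mathcomp Require Import all_classical all_reals topology normedtype.

Set Implicit Arguments.
Unset Strict Implicit.
Unset Printing Implicit Defensive.

Import Order.TTheory GRing.Theory Num.Theory.
Import numFieldNormedType.Exports.

Local Open Scope classical_set_scope.
Local Open Scope ring_scope.

(** Around a point of [Map(H, X) * Y] take the product of small neighbourhoods
    of its coordinates. If [(phi, h)] moves a point of this box back into the
    box, then [h = 1] because of the factor [Y]; so the coordinates are not
    permuted, and each [phi k] is [1] because of the [k]-th factor. Finiteness
    of [H] makes the box a neighbourhood ([wreath_wandering]). An action with
    such neighbourhoods is free, its orbit map is a covering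
    ([wandering_covering]), and the action itself supplies enough deck
    transformations ([covering_regular]).

    The homotopy groups are computed by lifting. [homotopy_lifting] lifts a
    homotopy through a covering, for an arbitrary parameter space; as a cube
    and a cylinder over a cube contract to a corner, it lifts based maps and
    homotopies between them ([lift_exists], [lift_homotopy]). When [n >= 2] the
    boundary of the cube is connected, so the lift of a based map is again
    based, and the covering induces an isomorphism on the n-th homotopy groups
    ([covering_higher_homotopy]). A map into a product is the family of its
    coordinates, which gives the groups of [Map(H, X) * Y]
    ([homotopy_group_product]).

    For the fundamental group ([fundamental_group_wreath]) lift a loop from the
    point [(x, ..., x; y)] to a path with coordinates [alpha k] and [eta]. It
    ends at the image of its origin under some [(phi, h)], so [alpha k] ends at
    [phi k x] and [eta] at [h y]: these paths project to loops in [X/G] and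
    [Y/H], and [h] is the boundary of the latter loop. Conversely, any family of
    loops in [X/G] and any loop in [Y/H] arise in this way. The lift of a
    concatenation continues with the second lift translated by [(phi, h)],
    whose coordinates are [phi k (alpha' (k h))]. The projection to [X/G]
    forgets [phi k], and what remains is the shift of the index by the boundary
    [h], which is the multiplication of the wreath product.

    The base points in the statement are arbitrary, so the computations, made
    at convenient points, are moved along paths ([base_change]). All these
    isomorphisms come from relations between representatives
    ([homotopy_group_iso]): lifts, transports along a path and coordinates are
    relations between maps, compatible with homotopy and with concatenation. *)

Arguments based_continuous {R T n x} b : rename.

(** * Coverings: lifting of paths and homotopies *)

Lemma within_comp_within (Z V T : topologicalType) (A : set Z) (B : set V)
    (k : Z -> V) (f : V -> T) :
  {within A, continuous k} -> (forall z, A z -> B (k z)) ->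
  {within B, continuous f} -> {within A, continuous (f \o k)}.
Proof.
move=> /withinP ck kAB /withinP cf; apply/withinP => x Ax W Wf.
have := ck x Ax _ (cf (k x) (kAB x Ax) W Wf).
by apply: filterS => z h Az; exact: h (kAB z Az).
Qed.

Lemma within_pair (Z U V : topologicalType) (A : set Z)
    (f : Z -> U) (g : Z -> V) :
  {within A, continuous f} -> {within A, continuous g} ->
  {within A, continuous (fun z => (f z, g z) : U * V)}.
Proof.
move=> /withinP cf /withinP cg; apply/withinP => x Ax W [[P Q] [/= Pf Qg] PQW].
apply: filterS2 (cf x Ax P Pf) (cg x Ax Q Qg) => z hP hQ Az.
by apply: PQW; split; [exact: hP | exact: hQ].
Qed.

Lemma continuous_comp_within (Z V T : topologicalType) (A : set Z)
    (k : Z -> V) (f : V -> T) :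
  continuous f -> {within A, continuous k} -> {within A, continuous (f \o k)}.
Proof.
move=> cf ck; apply: (within_comp_within (B := setT) ck) => //.
exact: continuous_subspaceT.
Qed.

(** Connectedness of the interval as an induction principle: a property that
    holds at [0], and that locally propagates to the right, holds everywhere.
    The step only gives information about subintervals [[u, v]] contained in
    the chosen neighbourhood, so a neighbourhood need not be convex. *)
Lemma interval_induction (R : realType) (P : R -> Prop) :
  P 0 ->
  (forall s, unit_interval s -> exists2 W, nbhs s W &
     forall u v, unit_interval u -> unit_interval v -> u <= v ->
       (forall w, u <= w <= v -> W w) -> P u -> P v) ->
  forall s, unit_interval s -> P s.
Proof.
move=> P0 step s1 /andP[s10 s11].
pose S := [set s | 0 <= s <= s1 /\ P s].
have S0 : S 0 by split=> //; rewrite lexx.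
have ubS : ubound S s1 by move=> s [/andP[]].
have hS : has_sup S by split; [exists 0 | exists s1].
pose a := sup S.
have a0 : 0 <= a by exact: (ub_le_sup hS.2 S0).
have as1 : a <= s1 by apply: ge_sup => //; exists 0.
have aI : unit_interval a by rewrite /unit_interval /= a0 (le_trans as1).
have [W /nbhs_ballP[e /= e0 eW] aW] := step a aI.
have [u [uI Pu] au] := sup_adherent e0 hS.
have ua : u <= a by exact: (ub_le_sup hS.2 (conj uI Pu)).
(* [P] is reached at [v]; if [v] were not the end [s1], it would exceed the
   supremum [a]. *)
pose v := Num.min s1 (a + e / 2).
have av : a <= v by rewrite /v le_min as1 lerDl divr_ge0 // ltW.
have vs1 : v <= s1 by rewrite /v ge_min lexx.
have va : v <= a + e / 2 by rewrite /v ge_min lexx orbT.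
have Pv : P v.
  apply: (aW u v) => //.
  - by rewrite /unit_interval /=; lra.
  - by rewrite /unit_interval /=; lra.
  - exact: le_trans av.
  - move=> w wuv; apply: eW; rewrite /ball /= ltr_norml; move: au; rewrite -/a; lra.
have vS : v <= a by apply: (ub_le_sup hS.2); split => //; lra.
move: Pv; rewrite /v /Num.min; case: ifP => // h.
by move: vS; rewrite /v /Num.min h; lra.
Qed.

Section lifting.
Context {R : realType} {E B : topologicalType} {p : E -> B}.
Hypothesis cov : covering p.

(** Locally, both lifts stay in a sheet each; when they agree at one point the
    sheets are the same, and the projection is injective on it. *)
Lemma path_lift_unique (l l' : R -> E) :
  {within unit_interval, continuous l} ->
  {within unit_interval, continuous l'} ->
  (forall s, unit_interval s -> p (l s) = p (l' s)) -> l 0 = l' 0 ->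
  forall s, unit_interval s -> l s = l' s.
Proof.
case: cov => cp _ ev /withinP cl /withinP cl' pl l0.
apply: interval_induction => // s sI.
have [U [oU Us [J [V [oV tV pU hV]]]]] := ev (p (l s)).
have [i _ Vi] : (\bigcup_i V i) (l s) by rewrite -pU.
have [j _ Vj] : (\bigcup_i V i) (l' s) by rewrite -pU /= -pl.
exists [set u | unit_interval u -> V i (l u) /\ V j (l' u)].
  have h1 := cl s sI _ (open_nbhs_nbhs (conj (oV i) Vi)).
  have h2 := cl' s sI _ (open_nbhs_nbhs (conj (oV j) Vj)).
  by apply: filterS2 h1 h2 => u hu hu' uI; split; [exact: hu | exact: hu'].
move=> u v uI vI uv hW luu.
have [Viu Vju] := hW u (introT andP (conj (lexx u) uv)) uI.
have [Viv Vjv] := hW v (introT andP (conj uv (lexx v))) vI.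
have ij : i = j by apply: tV => //; exists (l u); split => //; rewrite luu.
rewrite -ij in Vjv.
have [sg [_ _ sgK _]] := hV i.
by rewrite -(sgK _ Viv).2 pl // (sgK _ Vjv).2.
Qed.

Section homotopy_lifting.
Context {Z : topologicalType} {A : set Z} {F : Z * R -> B} {g : Z -> E}.
Hypothesis cF : {within A `*` unit_interval, continuous F}.
Hypothesis cg : {within A, continuous g}.
Hypothesis pg : forall z, A z -> p (g z) = F (z, 0).

(** The induction along the interval is on the time [s] that the lift has
    reached; it is stated with a variable [N] because prolonging the lift
    costs a shrinking of the parameter space. *)
Let lift_upto (N : set Z) (s : R) (L : Z * R -> E) :=
  [/\ {within (N `&` A) `*` [set u | 0 <= u <= s], continuous L},
      forall z u, N z -> A z -> 0 <= u <= s -> p (L (z, u)) = F (z, u) &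
      forall z, N z -> A z -> L (z, 0) = g z].

(** Near the point [(z0, s)] the homotopy stays in an evenly covered set. The
    lift known up to a time [u] close to [s] is prolonged by the section over
    the sheet that contains its value at [(z0, u)]; by continuity the same sheet
    serves for all parameters close to [z0], which is why the neighbourhood of
    [z0] has to shrink at each step. *)
Lemma local_homotopy_lifting z0 : A z0 ->
  exists2 N, nbhs z0 N & exists L, lift_upto N 1 L.
Proof.
move=> Az0; case: cov => cp _ ev.
suff : forall s, unit_interval s ->
    exists2 N, nbhs z0 N & exists L, lift_upto N s L.
  by apply; exact: unit_interval1.
apply: interval_induction.
  exists setT; first exact: filterT.
  exists (g \o fst); split => [||//].
  - apply: (within_comp _ _ cg); first exact: fst_continuous.
    by move=> z [[]].
  - by move=> z u _ Az /= u0; rewrite pg // (_ : u = 0) //; lra.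
move=> s sI.
have [U [oU Us [J [V [oV tV pU hV]]]]] := ev (F (z0, s)).
move/withinP: (cF) => cF'.
have [[N0 W] /= [N0z Ws] N0W] :=
  cF' (z0, s) (conj Az0 sI) _ (open_nbhs_nbhs (conj oU Us)).
exists W => // u v uI vI uv hW [N Nz [L [cL pL L0]]].
have uu : 0 <= u <= u by move: uI; rewrite /unit_interval /=; lra.
have Wu : W u by apply: hW; rewrite lexx.
have FU z w : N0 z -> A z -> W w -> unit_interval w -> U (F (z, w)).
  by move=> N0z' Az Ww wI; apply: (N0W (z, w)).
have N0z0 := nbhs_singleton N0z.
have Nz0 := nbhs_singleton Nz.
have [i _ Vi] : (\bigcup_i V i) (L (z0, u)).
  by rewrite -pU /= pL //; exact: FU.
move/withinP: (cL) => cL'.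
have [[N1 W1] /= [N1z W1u] N1W1] := cL' (z0, u)
  (conj (conj Nz0 Az0) uu) _ (open_nbhs_nbhs (conj (oV i) Vi)).
have LV z : N z -> A z -> N1 z -> V i (L (z, u)).
  move=> Nz' Az N1z'; apply: (N1W1 (z, u)) => //.
  by split => //=; exact: nbhs_singleton W1u.
have [sg [_ csg sgK sgU]] := hV i.
exists (N `&` (N0 `&` N1)); first by do 2!apply: filterI => //.
exists (fun z => if z.2 <= u then L z else sg (F z)); split.
- apply: within_if.
  + exact: snd_continuous.
  + apply: continuous_subspaceW cL => -[z w] [[/= [[Nz' _] Az] w0] wu].
    by split => //=; move: w0 wu; lra.
  + apply: (within_comp_within (k := F) _ _ csg).
      apply: continuous_subspaceW cF => -[z w] [[/= [[Nz' _] Az] w0] wu].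
      by split => //=; move: w0 wu vI; rewrite /unit_interval /=; lra.
    move=> -[z w] [[/= [[Nz' [N0z' _]] Az] w0] wu]; apply: FU => //.
      by apply: hW; move: w0 wu; lra.
    by move: w0 wu vI; rewrite /unit_interval /=; lra.
  + move=> [z w] /= [[[Nz' [N0z' N1z']] Az] w0] ->.
    by rewrite -(pL z u) // (sgK _ _).2 //; exact: LV.
- move=> z w /= [Nz' [N0z' N1z']] Az w0; case: ifPn => wu.
    by apply: pL => //; lra.
  apply: (sgU _ _).2; apply: FU => //.
    by apply: hW; move: w0 wu; lra.
  by move: w0 wu vI; rewrite /unit_interval /=; lra.
- move=> z [Nz' _] Az /=; rewrite ifT; first exact: L0.
  by lra.
Qed.

(** The local lifts restrict to lifts of paths, which are unique; hence they
    agree where they overlap, and glue. *)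
Lemma homotopy_lifting : exists L : Z * R -> E,
  [/\ {within A `*` unit_interval, continuous L},
      forall z s, A z -> unit_interval s -> p (L (z, s)) = F (z, s) &
      forall z, A z -> L (z, 0) = g z].
Proof.
have h z : exists NL : set Z * (Z * R -> E),
    A z -> nbhs z NL.1 /\ lift_upto NL.1 1 NL.2.
  have [Az|nAz] := pselect (A z); last by exists (set0, g \o fst).
  by have [N Nz [L hL]] := local_homotopy_lifting Az; exists (N, L).
have [NL hNL] := choice h.
pose L (z : Z * R) := (NL z.1).2 z.
have cL0 (N : set Z) L0 : lift_upto N 1 L0 -> forall z, N z -> A z ->
    {within unit_interval, continuous (fun s => L0 (z, s))}.
  case=> c0 _ _ z Nz Az.
  apply: (within_comp (k := fun s : R => (z, s) : Z * R) _ _ c0) => //.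
  by apply: pair_continuous => s; [exact: cvg_cst | exact: cvg_id].
have key z0 z s : A z0 -> A z -> (NL z0).1 z -> unit_interval s ->
    L (z, s) = (NL z0).2 (z, s).
  move=> Az0 Az Nz sI.
  have [Nz0 h0] := hNL _ Az0; have [Nzz hz] := hNL _ Az.
  have Nz' := nbhs_singleton Nzz.
  apply: (path_lift_unique (l := fun s => L (z, s))
     (l' := fun s => (NL z0).2 (z, s))) => //.
  - exact: (cL0 _ _ hz).
  - exact: (cL0 _ _ h0).
  - by move=> u uI; case: hz h0 => _ -> // _ [_ -> //].
  - by case: hz h0 => _ _ e1 [_ _ e2]; rewrite /L e1 // e2.
exists L; split.
- apply/withinP => -[z0 s0] [/= Az0 s0I] W.
  have [Nz0 [c0 _ _]] := hNL _ Az0.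
  have Nz0' := nbhs_singleton Nz0.
  rewrite (key z0 z0 s0) // => LW; move/withinP: c0 => c0.
  have h1 := c0 (z0, s0) (conj (conj Nz0' Az0) s0I) W LW.
  have h2 : \forall z \near (z0, s0), (NL z0).1 z.1.
    exact: (@fst_continuous _ _ (z0, s0) _ Nz0).
  apply: filterS2 h1 h2 => -[z s] q1 /= q2 [/= Az sI].
  by rewrite (key z0) //; apply: q1.
- move=> z s Az sI; have [/nbhs_singleton Nz [_ q _]] := hNL _ Az.
  exact: q.
- by move=> z Az; have [/nbhs_singleton Nz [_ _ q]] := hNL _ Az; exact: q.
Qed.

End homotopy_lifting.
End lifting.

(** A contraction of [A] inside [A] that fixes the centre [z0]: it turns the
    lifting of maps on [A] into the lifting of homotopies. *)
Definition contracts (R : realType) (Z : topologicalType) (A : set Z) (z0 : Z)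
    (K : Z * R -> Z) :=
  [/\ continuous K, forall z s, A z -> unit_interval s -> A (K (z, s)),
      forall z, K (z, 0) = z0, forall z, K (z, 1) = z &
      forall s, K (z0, s) = z0].

Section lifting_contractible.
Context {R : realType} {E B : topologicalType} {p : E -> B}.
Hypothesis cov : covering p.
Context {Z : topologicalType} {A : set Z} {z0 : Z} {K : Z * R -> Z}.
Hypothesis cK : contracts A z0 K.

Let slice_continuous z : continuous (fun s => K (z, s)).
Proof.
case: cK => c _ _ _ _ s; apply: (@continuous_comp _ _ _ (pair z) K).
  by apply: pair_continuous => {}s; [exact: cvg_cst | exact: cvg_id].
exact: c.
Qed.

(** Any point of [A] is joined to [z0] by its track under the contraction, along
    which lifts of paths are unique. *)
Lemma lift_unique (l l' : Z -> E) :
  {within A, continuous l} -> {within A, continuous l'} ->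
  (forall z, A z -> p (l z) = p (l' z)) -> l z0 = l' z0 ->
  forall z, A z -> l z = l' z.
Proof.
move=> cl cl' pl l0 z Az; case: cK => _ KA K0 K1 _.
rewrite -(K1 z).
apply: (path_lift_unique cov (l := fun s => l (K (z, s)))
  (l' := fun s => l' (K (z, s)))).
- by apply: (within_comp (@slice_continuous z) _ cl) => s; exact: KA.
- by apply: (within_comp (@slice_continuous z) _ cl') => s; exact: KA.
- by move=> s sI; apply: pl; exact: KA.
- by rewrite K0.
- exact: unit_interval1.
Qed.

(** Composed with the contraction, [f] becomes a homotopy from a constant map
    to [f]; the lift is the end of the lifted homotopy. *)
Lemma lift_exists (f : Z -> B) (e : E) :
  A z0 -> {within A, continuous f} -> p e = f z0 ->
  exists l : Z -> E, [/\ {within A, continuous l},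
    forall z, A z -> p (l z) = f z & l z0 = e].
Proof.
move=> A0 cf pe; have [cK' KA K0 K1 Kz] := cK.
have cfK : {within A `*` unit_interval, continuous (f \o K)}.
  by apply: within_comp cf => // -[z s] [Az sI]; exact: KA.
have ce : {within A, continuous (fun=> e)}.
  exact/continuous_subspaceT/cst_continuous.
have pe0 z : A z -> p e = (f \o K) (z, 0) by rewrite /= K0.
have [L [cL pL L0]] := homotopy_lifting cov cfK ce pe0.
exists (fun z => L (z, 1)); split.
- apply: (within_comp (k := fun z => (z, 1) : Z * R) _ _ cL).
    by apply: pair_continuous => s; [exact: cvg_id | exact: cvg_cst].
  by move=> z Az; split => //; exact: unit_interval1.
- by move=> z Az; rewrite pL //= ?K1 //; exact: unit_interval1.
- rewrite -(L0 z0 A0).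
  apply: (path_lift_unique cov (l := fun s => L (z0, s))
    (l' := fun=> L (z0, 0))) => //.
  + apply: (within_comp (k := fun s => (z0, s) : Z * R) _ _ cL) => //.
    by apply: pair_continuous => s; [exact: cvg_cst | exact: cvg_id].
  + exact/continuous_subspaceT/cst_continuous.
  + by move=> s sI; rewrite !pL //= ?Kz //; exact: unit_interval0.
  + exact: unit_interval1.
Qed.

End lifting_contractible.

(** A lift of a constant path is constant, since constant paths are lifts. *)
Lemma lift_constant_along (R : realType) (E B Z : topologicalType) (p : E -> B)
    (A : set Z) (l : Z -> E) (c : R -> Z) b :
  covering p -> {within A, continuous l} -> continuous c ->
  (forall s, unit_interval s -> A (c s)) ->
  (forall s, unit_interval s -> p (l (c s)) = b) ->
  l (c 1) = l (c 0).
Proof.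
move=> cov cl cc cA pb.
apply: (path_lift_unique cov (l := fun s => l (c s)) (l' := fun=> l (c 0))).
- exact: within_comp cl.
- exact/continuous_subspaceT/cst_continuous.
- by move=> s sI; rewrite !pb //; exact: unit_interval0.
- by [].
- exact: unit_interval1.
Qed.

Section cubes.
Context {R : realType}.

Lemma scale_row_continuous (Z : topologicalType) n (u : Z -> R)
    (k : Z -> 'rV[R]_n) :
  continuous u -> continuous k -> continuous (fun z => u z *: k z).
Proof.
move=> cu ck; apply: row_continuous => i.
rewrite (_ : (fun _ => _) = (fun z => u z * k z ord0 i)); last first.
  by apply/funext => z; rewrite mxE.
move=> z; apply: cvgM; first exact: cu.
apply: (@continuous_comp _ _ _ k (fun t : 'rV[R]_n => t ord0 i)); first exact: ck.
exact: coord_continuous.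
Qed.

Lemma scale_cube n (t : 'rV[R]_n) s :
  cube n t -> unit_interval s -> cube n (s *: t).
Proof.
move=> ct sI i; rewrite mxE; move: (ct i) sI; rewrite /unit_interval /=; nra.
Qed.

Lemma cube0 n : cube n (0 : 'rV[R]_n).
Proof. by move=> i; rewrite mxE; exact: unit_interval0. Qed.

Lemma cube_contracts n :
  contracts (cube n) (0 : 'rV[R]_n) (fun z : 'rV[R]_n * R => z.2 *: z.1).
Proof.
split => /=.
- by apply: scale_row_continuous; [exact: snd_continuous | exact: fst_continuous].
- by move=> z s; exact: scale_cube.
- by move=> z; rewrite scale0r.
- by move=> z; rewrite scale1r.
- by move=> s; rewrite scaler0.
Qed.

Lemma cylinder_contracts n :
  contracts (unit_interval `*` cube n) ((0, 0) : R * 'rV[R]_n)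
    (fun z : (R * 'rV[R]_n) * R => (z.2 * z.1.1, z.2 *: z.1.2) : R * 'rV[R]_n).
Proof.
have c1 : continuous (fun z : (R * 'rV[R]_n) * R => z.1.1).
  by move=> z; apply: (@continuous_comp _ _ _ fst fst); exact: fst_continuous.
have c2 : continuous (fun z : (R * 'rV[R]_n) * R => z.1.2).
  move=> z; apply: (@continuous_comp _ _ _ fst snd).
    exact: fst_continuous.
  exact: snd_continuous.
split => /=.
- apply: pair_continuous.
    by move=> z; apply: cvgM; [exact: snd_continuous | exact: c1].
  by apply: scale_row_continuous; [exact: snd_continuous | exact: c2].
- move=> [u t] s [/= uI ct] sI; split => /=; last exact: scale_cube.
  by move: uI sI; rewrite /unit_interval /=; nra.
- by move=> z; rewrite mul0r scale0r.
- by move=> [u t]; rewrite mul1r scale1r.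
- by move=> s; rewrite mulr0 scaler0.
Qed.

End cubes.

(** * Isomorphisms from relations between representatives *)

Lemma bij_group_isomorphic (G K : groupType) (f : G -> K) :
  {morph f : a b / (a * b)%g} -> injective f -> (forall b, exists a, f a = b) ->
  group_isomorphic G K.
Proof.
move=> fM finj fsurj.
have f1 : f 1%g = 1%g.
  by apply: (@mulgI K (f 1%g)); rewrite -fM !mulg1.
pose F := HB.pack_for (UMagmaMorphism.type G K) f
  (isUMagmaMorphism.Build G K f (conj f1 fM)).
have [g gK] := choice fsurj.
exists F, g; last exact: gK.
by move=> a; apply: finj; rewrite gK.
Qed.

Lemma group_isomorphic_trans (G K L : groupType) :
  group_isomorphic G K -> group_isomorphic K L -> group_isomorphic G L.
Proof.
move=> [f [f' fK f'K]] [g [g' gK g'K]].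
apply: (@bij_group_isomorphic _ _ (g \o f)).
- by move=> a b /=; rewrite !gmulfM.
- by apply: inj_comp; [exact: can_inj gK | exact: can_inj fK].
- by move=> b; exists (f' (g' b)); rewrite /= f'K g'K.
Qed.

Section isomorphism_from_relation.
Context {R : realType} {T : topologicalType}.

(** A relation between maps and elements of [K] that is total on both sides,
    multiplicative, and turns homotopy into equality, induces an isomorphism:
    the values on classes are chosen, and the third hypothesis makes the choice
    irrelevant. *)
Lemma homotopy_group_iso n (x : T) (K : groupType)
    (Rel : based_map R n.+1 x -> K -> Prop) :
  (forall f, exists a, Rel f a) -> (forall a, exists f, Rel f a) ->
  (forall f g a b, Rel f a -> Rel g b -> (homotopic f g <-> a = b)) ->
  (forall f g a b, Rel f a -> Rel g b -> Rel (concat f g) (a * b)%g) ->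
  group_isomorphic (homotopy_group R n.+1 x) K.
Proof.
move=> Rtot Rsurj Rh RM; have [phi phiR] := choice Rtot.
pose Phi (a : homotopy_group R n.+1 x) := phi (repr a).
have PhiE f b : Rel f b -> Phi (homotopy_class f) = b.
  by move=> fb; apply: (proj1 (Rh _ _ _ _ (phiR _) fb)); exact: repr_homotopic.
apply: (@bij_group_isomorphic _ _ Phi).
- move=> a b; have [f ->] := homotopy_class_surj a.
  have [g ->] := homotopy_class_surj b.
  have -> : (homotopy_class f * homotopy_class g)%g = homotopy_class (concat f g).
    exact: homotopy_mulE.
  rewrite (PhiE f _ (phiR f)) (PhiE g _ (phiR g)).
  by apply: PhiE; apply: RM; exact: phiR.
- move=> a b; have [f ->] := homotopy_class_surj a.
  have [g ->] := homotopy_class_surj b.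
  rewrite (PhiE f _ (phiR f)) (PhiE g _ (phiR g)) => fg.
  by apply/homotopy_classP/(Rh _ _ _ _ (phiR f) (phiR g)).
- by move=> b; have [f fb] := Rsurj b; exists (homotopy_class f); exact: PhiE.
Qed.

Lemma concat_eq n (x : T) (f f' g g' : based_map R n.+1 x) :
  (forall t, cube n.+1 t -> f t = f' t) -> (forall t, cube n.+1 t -> g t = g' t) ->
  forall t, cube n.+1 t -> concat f g t = concat f' g' t.
Proof.
move=> ff gg t ct; have := ct ord0; rewrite /= /concat_fun /unit_interval /=.
by case: ifPn => t0 t01; [apply: ff | apply: gg];
  apply: set_first_cube => //; rewrite /unit_interval /=; lra.
Qed.

End isomorphism_from_relation.

Section maps_of_spaces.
Context {R : realType} {T T' : topologicalType}.

Lemma homotopy_group_iso_rel n (x : T) (x' : T')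
    (Rel : based_map R n.+1 x -> based_map R n.+1 x' -> Prop) :
  (forall f, exists f', Rel f f') -> (forall f', exists f, Rel f f') ->
  (forall f g f' g', Rel f f' -> Rel g g' -> (homotopic f g <-> homotopic f' g')) ->
  (forall f g f' g', Rel f f' -> Rel g g' -> Rel (concat f g) (concat f' g')) ->
  group_isomorphic (homotopy_group R n.+1 x) (homotopy_group R n.+1 x').
Proof.
move=> Rtot Rsurj Rh RM.
apply: (@homotopy_group_iso R T n x _
  (fun f a => exists2 f', Rel f f' & a = homotopy_class f')).
- by move=> f; have [f' ff'] := Rtot f; exists (homotopy_class f'), f'.
- move=> a; have [f' ->] := homotopy_class_surj a.
  by have [f ff'] := Rsurj f'; exists f, f'.
- move=> f g a b [f' ff' ->] [g' gg' ->]; rewrite (Rh _ _ _ _ ff' gg').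
  by symmetry; exact: homotopy_classP.
- move=> f g a b [f' ff' ->] [g' gg' ->]; exists (concat f' g'); first exact: RM.
  exact: homotopy_mulE.
Qed.

Variables (k : T -> T') (ck : continuous k).

Lemma push_within n (x : T) (f : based_map R n x) :
  {within cube n, continuous (k \o f)}.
Proof.
exact: continuous_comp_within ck (based_continuous f).
Qed.

Definition push n (x : T) (f : based_map R n x) : based_map R n (k x) :=
  BasedMap (@push_within n x f) (fun t bt => congr1 k (based_boundary f bt)).

Lemma push_homotopic n (x : T) (f g : based_map R n x) :
  homotopic f g -> homotopic (push f) (push g).
Proof.
move=> [F [cF F0 F1 Fb]]; exists (k \o F); split.
- exact: continuous_comp_within.
- by move=> t ct /=; rewrite F0.
- by move=> t ct /=; rewrite F1.
- by move=> s t sI bt /=; rewrite Fb.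
Qed.

Lemma push_concat n (x : T) (f g : based_map R n.+1 x) t :
  push (concat f g) t = concat (push f) (push g) t.
Proof. by rewrite /= /concat_fun; case: ifP. Qed.

End maps_of_spaces.

Section collar.
Context {R : realType}.

(** * Change of base point *)

(** Maximum norm of [2 t - 1]: the concentric cubes are its level sets, and the
    boundary of the unit cube is the level [1]. *)
Definition gauge n (t : 'rV[R]_n) : R :=
  \big[Num.max/0]_(i < n) `|2 * t ord0 i - 1|.

(** Homothety of ratio [1 + s] whose centre is that of the unit cube. *)
Definition dilate n (s : R) (t : 'rV[R]_n) : 'rV[R]_n :=
  \row_i (((1 + s) * (2 * t ord0 i - 1) + 1) / 2).

Lemma gauge_ge0 n (t : 'rV[R]_n) : 0 <= gauge t.
Proof. by rewrite /gauge; elim/big_ind: _ => // u v u0 v0; rewrite le_max u0. Qed.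

Lemma gauge_ge n (t : 'rV[R]_n) i : `|2 * t ord0 i - 1| <= gauge t.
Proof. exact: (@le_bigmax _ _ _ 0 (fun i => `|2 * t ord0 i - 1|) i). Qed.

Lemma gauge_le n (t : 'rV[R]_n) c :
  0 <= c -> (forall i, `|2 * t ord0 i - 1| <= c) -> gauge t <= c.
Proof. by move=> c0 tc; apply: bigmax_le => // i _. Qed.

Lemma gauge_attained n (t : 'rV[R]_n) :
  0 < gauge t -> exists i, `|2 * t ord0 i - 1| = gauge t.
Proof.
rewrite /gauge => g0; apply: contrapT => /forallNP h.
suff : gauge t < gauge t by rewrite ltxx.
rewrite {1}/gauge; apply: bigmax_lt => // i _.
by rewrite lt_neqAle gauge_ge andbT; apply/eqP/h.
Qed.

Lemma double_continuous (Z : topologicalType) (u : Z -> R) :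
  continuous u -> continuous (fun z => 2 * u z).
Proof. by move=> cu z; apply: cvgM; [exact: cvg_cst | exact: cu]. Qed.

Lemma double_sub1_continuous (Z : topologicalType) (u : Z -> R) :
  continuous u -> continuous (fun z => 2 * u z - 1).
Proof.
by move=> /double_continuous cu z; apply: cvgB; [exact: cu | exact: cvg_cst].
Qed.

Lemma gauge_continuous n : continuous (@gauge n).
Proof.
rewrite /gauge; elim: (index_enum _) => [|i r IH].
  rewrite [X in continuous X](_ : _ = fun=> 0); first exact: cst_continuous.
  by apply/funext => u; rewrite big_nil.
rewrite [X in continuous X](_ : _ = fun u : 'rV[R]_n =>
  Num.max `|2 * u ord0 i - 1| (\big[Num.max/0]_(j <- r) `|2 * u ord0 j - 1|)).
  have cc : continuous (fun u : 'rV[R]_n => u ord0 i) by exact: coord_continuous.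
  have ca := double_sub1_continuous cc.
  move=> t; apply: (@continuous_max R 'rV[R]_n (fun u => `|2 * u ord0 i - 1|)
    (fun u => \big[Num.max/0]_(j <- r) `|2 * u ord0 j - 1|)); last exact: IH.
  apply: (@continuous_comp _ R R _ Num.norm); first exact: ca.
  exact: norm_continuous.
by apply/funext => u; rewrite big_cons.
Qed.

Lemma gauge_cube n (t : 'rV[R]_n) : cube n t -> gauge t <= 1.
Proof.
move=> ct; apply: gauge_le => // i; rewrite ler_norml.
by move: (ct i); rewrite /unit_interval /=; lra.
Qed.

Lemma gauge_boundary n (t : 'rV[R]_n) : cube_boundary t -> gauge t = 1.
Proof.
move=> [ct [i ti]]; apply/eqP; rewrite eq_le gauge_cube //=.
apply: le_trans (gauge_ge t i); rewrite ler_normr.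
by apply/orP; case: ti => ->; [right | left]; lra.
Qed.

Lemma dilate0 n (t : 'rV[R]_n) : dilate 0 t = t.
Proof. by apply/rowP => i; rewrite mxE; field. Qed.

Lemma dilate_cube n (t : 'rV[R]_n) s :
  0 <= s -> (1 + s) * gauge t <= 1 -> cube n (dilate s t).
Proof.
move=> s0 ts i; rewrite mxE /unit_interval /=.
have := gauge_ge t i; rewrite ler_norml => /andP[h1 h2].
by apply/andP; split; nra.
Qed.

Lemma dilate_boundary n (t : 'rV[R]_n) s :
  0 <= s -> (1 + s) * gauge t = 1 -> cube_boundary (dilate s t).
Proof.
move=> s0 ts; split; first by apply: dilate_cube; rewrite ?ts.
have g0 : 0 < gauge t.
  rewrite lt_neqAle gauge_ge0 andbT; apply/eqP => g0.
  by move: ts; rewrite -g0 mulr0 => /eqP; rewrite eq_sym oner_eq0.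
have [i ti] := gauge_attained g0; exists i; rewrite mxE.
move: ts; rewrite -ti; case: (ger0P (2 * t ord0 i - 1)) => _ ts;
  [right | left]; lra.
Qed.

Lemma dilate_continuous (Z : topologicalType) n (u : Z -> R) (k : Z -> 'rV[R]_n) :
  continuous u -> continuous k -> continuous (fun z => dilate (u z) (k z)).
Proof.
move=> cu ck; apply: row_continuous => i.
rewrite (_ : (fun _ => _) =
  (fun z => ((1 + u z) * (2 * k z ord0 i - 1) + 1) / 2)); last first.
  by apply/funext => z; rewrite mxE.
move=> z; apply: cvgM; last exact: cvg_cst.
apply: cvgD; last exact: cvg_cst.
apply: cvgM; first by apply: cvgD; [exact: cvg_cst | exact: cu].
apply: cvgB; last exact: cvg_cst.
apply: cvgM; first exact: cvg_cst.
apply: (@continuous_comp _ _ _ k (fun t : 'rV[R]_n => t ord0 i)); first exact: ck.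
exact: coord_continuous.
Qed.

(** [f], shrunk by the factor [1 + s] to a concentric cube, and surrounded by a
    collar on which the path [c] is traversed radially: on the boundary of the
    unit cube the value is [c s]. *)
Definition collar (T : Type) n (f : 'rV[R]_n -> T) (c : R -> T) (s : R)
    (t : 'rV[R]_n) : T :=
  if (1 + s) * gauge t <= 1 then f (dilate s t) else c ((1 + s) * gauge t - 1).

Lemma collar0 (T : Type) n (f : 'rV[R]_n -> T) c t :
  cube n t -> collar f c 0 t = f t.
Proof. by move=> ct; rewrite /collar addr0 mul1r gauge_cube // dilate0. Qed.

Lemma collar_boundary (T : Type) n (f : 'rV[R]_n -> T) c s t :
  unit_interval s -> cube_boundary t ->
  (forall t, cube_boundary t -> f t = c 0) -> collar f c s t = c s.
Proof.
move=> sI bt fc; rewrite /collar gauge_boundary // mulr1; case: ifPn => s0.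
  have -> : s = 0 by move: sI s0; rewrite /unit_interval /=; lra.
  by rewrite dilate0 fc.
by congr c; ring.
Qed.

Lemma collar_eq (T : Type) n (f f' : 'rV[R]_n -> T) (c c' : R -> T) s t :
  (forall t, cube n t -> f t = f' t) -> (forall r, unit_interval r -> c r = c' r) ->
  unit_interval s -> cube n t -> collar f c s t = collar f' c' s t.
Proof.
move=> ff cc sI ct; rewrite /collar; case: ifPn => st.
  by apply/ff/dilate_cube => //; move: sI; rewrite /unit_interval /=; lra.
apply: cc; have := gauge_cube ct; have := gauge_ge0 t; move: sI st.
by rewrite /unit_interval /=; nra.
Qed.

Lemma collar_within (Z T : topologicalType) n (A : set Z) (k : Z -> 'rV[R]_n)
    (u : Z -> R) (F : Z * 'rV[R]_n -> T) (C : Z * R -> T) :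
  continuous k -> continuous u -> (forall z, A z -> cube n (k z)) ->
  (forall z, A z -> unit_interval (u z)) ->
  {within A `*` cube n, continuous F} ->
  {within A `*` unit_interval, continuous C} ->
  (forall z t, A z -> cube_boundary t -> F (z, t) = C (z, 0)) ->
  {within A, continuous (fun z =>
    collar (fun t => F (z, t)) (fun r => C (z, r)) (u z) (k z))}.
Proof.
move=> ck cu kA uA cF cC FC.
pose v z := (1 + u z) * gauge (k z).
have cv : continuous v.
  move=> z; apply: cvgM; first by apply: cvgD; [exact: cvg_cst | exact: cu].
  apply: (@continuous_comp _ _ _ k (@gauge n)); first exact: ck.
  exact: gauge_continuous.
have v2 z : A z -> v z <= 2.
  move=> Az; have := gauge_cube (kA z Az); have := gauge_ge0 (k z).
  by have := uA z Az; rewrite /v /unit_interval /=; nra.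
apply: (within_if (u := v) (f := fun z => F (z, dilate (u z) (k z)))
  (g := fun z => C (z, v z - 1))).
- exact: cv.
- apply: (within_comp
    (k := fun z => (z, dilate (u z) (k z)) : Z * 'rV[R]_n) _ _ cF).
    by apply: pair_continuous; [move=> z; exact: cvg_id | exact: dilate_continuous].
  move=> z [Az vz]; split => //=; apply: dilate_cube => //.
  by move: (uA z Az); rewrite /unit_interval /=; lra.
- apply: (within_comp (k := fun z => (z, v z - 1) : Z * R) _ _ cC).
    apply: pair_continuous; first by move=> z; exact: cvg_id.
    by move=> z; apply: cvgB; [exact: cv | exact: cvg_cst].
  move=> z [/= Az vz]; split => //=; move: (v2 z Az) vz.
  by rewrite /unit_interval /=; lra.
- move=> z Az vz; rewrite vz subrr; apply: FC => //; apply: dilate_boundary => //.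
  by move: (uA z Az); rewrite /unit_interval /=; lra.
Qed.

End collar.

Section free_homotopy.
Context {R : realType} {T : topologicalType}.

(** Homotopy between maps with different base points: the whole boundary of the
    cube moves along the path [c] that joins them. *)
Definition free_homotopic (c : R -> T) n (x x' : T) (f : based_map R n x)
    (f' : based_map R n x') :=
  exists F : R * 'rV[R]_n -> T,
    [/\ {within unit_interval `*` cube n, continuous F},
        forall t, cube n t -> F (0, t) = f t,
        forall t, cube n t -> F (1, t) = f' t &
        forall s t, unit_interval s -> cube_boundary t -> F (s, t) = c s].

Lemma free_homotopic_sym c n x x' (f : based_map R n x) (f' : based_map R n x') :
  free_homotopic c f f' -> free_homotopic (fun s => c (1 - s)) f' f.
Proof.
move=> [F [cF F0 F1 Fb]]; exists (fun z => F (1 - z.1, z.2)).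
have I1 s : @unit_interval R s -> unit_interval (1 - s).
  by rewrite /unit_interval /=; lra.
split => /=.
- apply: (within_comp
    (k := fun z : R * 'rV[R]_n => (1 - z.1, z.2) : R * 'rV[R]_n) _ _ cF).
    apply: pair_continuous; last exact: snd_continuous.
    exact/onem_continuous/fst_continuous.
  by move=> z [/I1 z1 z2].
- by move=> t ct; rewrite subr0 F1.
- by move=> t ct; rewrite subrr F0.
- by move=> s t /I1 s01 bt; exact: Fb.
Qed.

Lemma free_homotopic_trans c c' c'' n x x' x''
    (f : based_map R n x) (f' : based_map R n x') (f'' : based_map R n x'') :
  (forall s, unit_interval s -> s <= 2^-1 -> c'' s = c (2 * s)) ->
  (forall s, unit_interval s -> 2^-1 < s -> c'' s = c' (2 * s - 1)) ->
  free_homotopic c f f' -> free_homotopic c' f' f'' -> free_homotopic c'' f f''.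
Proof.
move=> cl cr [F [cF F0 F1 Fb]] [K [cK K0 K1 Kb]].
exists (fun z => if z.1 <= 2^-1 then F (2 * z.1, z.2) else K (2 * z.1 - 1, z.2)).
have c1 : continuous (fun z : R * 'rV[R]_n => 2 * z.1).
  by move=> z; apply: cvgM; [exact: cvg_cst | exact: fst_continuous].
split => /=.
- apply: within_if.
  + by move=> z; exact: fst_continuous.
  + apply: (within_comp
      (k := fun z : R * 'rV[R]_n => (2 * z.1, z.2) : R * 'rV[R]_n) _ _ cF).
      by apply: pair_continuous; [exact: c1 | exact: snd_continuous].
    by move=> z [[/= z1 z2] z3]; split => //=; move: z1 z3;
       rewrite /unit_interval/=; lra.
  + apply: (within_comp
      (k := fun z : R * 'rV[R]_n => (2 * z.1 - 1, z.2) : R * 'rV[R]_n) _ _ cK).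
      apply: pair_continuous; last exact: snd_continuous.
      by apply: double_sub1_continuous; exact: fst_continuous.
    by move=> z [[/= z1 z2] z3]; split => //=; move: z1 z3;
       rewrite /unit_interval/=; lra.
  + move=> [s t] [/= _ ct] ->; rewrite mulfV ?pnatr_eq0 // subrr.
    by rewrite F1 // K0.
- by move=> t ct; rewrite mulr0 invr_ge0 ler0n F0.
- move=> t ct; rewrite ifF; last by apply/negbTE; lra.
  by rewrite mulr1 (_ : 2 - 1 = 1) ?K1 //; lra.
- move=> s t s01 bt; case: ifPn => hs.
    by rewrite cl // Fb //; move: s01 hs; rewrite /unit_interval/=; lra.
  rewrite -ltNge in hs.
  by rewrite cr // Kb //; move: s01 hs; rewrite /unit_interval/=; lra.
Qed.

Lemma homotopic_free n (x : T) (f g : based_map R n x) :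
  homotopic f g -> free_homotopic (fun=> x) f g.
Proof. by []. Qed.

Lemma free_homotopic_concat (c : R -> T) n x x'
    (f g : based_map R n.+1 x) (f' g' : based_map R n.+1 x') :
  free_homotopic c f f' -> free_homotopic c g g' ->
  free_homotopic c (concat f g) (concat f' g').
Proof.
move=> [F [cF F0 F1 Fb]] [K [cK K0 K1 Kb]].
exists (fun z => concat_fun (fun t => F (z.1, t)) (fun t => K (z.1, t)) z.2).
have ctt (t : 'rV[R]_n.+1) : cube n.+1 t -> t ord0 ord0 <= 2^-1 ->
    cube n.+1 (set_first t (2 * t ord0 ord0)).
  move=> ct t0; apply: set_first_cube => //.
  by move: (ct ord0); rewrite /unit_interval /=; lra.
have ctt' (t : 'rV[R]_n.+1) : cube n.+1 t -> 2^-1 <= t ord0 ord0 ->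
    cube n.+1 (set_first t (2 * t ord0 ord0 - 1)).
  move=> ct t0; apply: set_first_cube => //.
  by move: (ct ord0); rewrite /unit_interval /=; lra.
have c0 : continuous (fun z : R * 'rV[R]_n.+1 => z.2 ord0 ord0).
  move=> z.
  apply: (@continuous_comp _ _ _ snd (fun t : 'rV[R]_n.+1 => t ord0 ord0)).
    exact: snd_continuous.
  exact: first_continuous.
have c2 : continuous (fun z : R * 'rV[R]_n.+1 => 2 * z.2 ord0 ord0).
  by move=> z; apply: cvgM; [exact: cvg_cst | exact: c0].
split => /=.
- apply: within_if; first exact: c0.
  + apply: (within_comp (k := fun z : R * 'rV[R]_n.+1 =>
      (z.1, set_first z.2 (2 * z.2 ord0 ord0)) : R * 'rV[R]_n.+1) _ _ cF).
      apply: pair_continuous; first exact: fst_continuous.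
      exact: (set_first_continuous (@snd_continuous _ _) c2).
    by move=> z [[z1 z2] z3]; split => //; exact: ctt.
  + apply: (within_comp (k := fun z : R * 'rV[R]_n.+1 =>
      (z.1, set_first z.2 (2 * z.2 ord0 ord0 - 1)) : R * 'rV[R]_n.+1) _ _ cK).
      apply: pair_continuous; first exact: fst_continuous.
      exact: (set_first_continuous (@snd_continuous _ _) (double_sub1_continuous c0)).
    by move=> z [[z1 z2] z3]; split => //; exact: ctt'.
  + move=> [s t] [/= sI ct] ->; rewrite mulfV ?pnatr_eq0 // subrr.
    by rewrite Fb ?Kb //; apply: set_first_end => //; [left | right].
- move=> t ct; rewrite /concat_fun; case: ifPn => t0; first exact/F0/ctt.
  by apply/K0/ctt'/ltW => //; rewrite ltNge.
- move=> t ct; rewrite /concat_fun; case: ifPn => t0; first exact/F1/ctt.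
  by apply/K1/ctt'/ltW => //; rewrite ltNge.
- by move=> s t sI bt; apply: concat_boundary => // t' bt'; [exact: Fb | exact: Kb].
Qed.

(** The collar along [c], with a width that grows with the time. *)
Lemma transport_exists (c : R -> T) n (x x' : T) (f : based_map R n x) :
  {within unit_interval, continuous c} -> c 0 = x -> c 1 = x' ->
  exists2 f' : based_map R n x', forall t, f' t = collar f c 1 t &
    free_homotopic c f f'.
Proof.
move=> cc c0 c1.
have fb t : cube_boundary t -> f t = c 0.
  by move=> bt; rewrite c0; exact: based_boundary.
have cF : {within unit_interval `*` cube n, continuous
    (fun z : R * 'rV[R]_n => collar f c z.1 z.2)}.
  apply: (@collar_within R _ T n (unit_interval `*` cube n)
    snd fst (fun z => f z.2) (fun z => c z.2)).
  - exact: snd_continuous.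
  - exact: fst_continuous.
  - by move=> z [].
  - by move=> z [].
  - apply: (within_comp (k := snd) _ _ (based_continuous f)).
      exact: snd_continuous.
    by move=> z [].
  - apply: (within_comp (k := snd) _ _ cc).
      exact: snd_continuous.
    by move=> z [].
  - by move=> z t _; exact: fb.
have cf' : {within cube n, continuous (collar f c 1)}.
  apply: (within_comp (k := fun t : 'rV[R]_n => (1, t) : R * 'rV[R]_n) _ _ cF).
    by apply: pair_continuous; [exact: cst_continuous | move=> t; exact: cvg_id].
  by move=> t ct; split => //; exact: unit_interval1.
have bf' t : cube_boundary t -> collar f c 1 t = x'.
  by move=> bt; rewrite collar_boundary //; exact: unit_interval1.
exists (BasedMap cf' bf') => //; exists (fun z => collar f c z.1 z.2); split => //.
- by move=> t ct; rewrite collar0.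
- by move=> s t sI bt /=; rewrite collar_boundary.
Qed.

(** When the track of the boundary is a null-homotopic loop, surround each stage
    of the homotopy by a collar that carries the null-homotopy [N]: then the
    boundary of the larger cube stays at [x]. The two ends acquire a constant
    collar, which can be removed by a homotopy. *)
Lemma free_homotopic_loop_homotopic n (x : T) (N : R * R -> T)
    (f f' : based_map R n x) :
  {within unit_interval `*` unit_interval, continuous N} ->
  (forall s, unit_interval s -> N (s, 1) = x) ->
  (forall r, unit_interval r -> N (0, r) = x) ->
  (forall r, unit_interval r -> N (1, r) = x) ->
  free_homotopic (fun s => N (s, 0)) f f' -> homotopic f f'.
Proof.
move=> cN Nx N0 N1 [F [cF F0 F1 Fb]].
have cx : {within unit_interval, continuous (fun _ : R => x)}.
  exact/continuous_subspaceT/cst_continuous.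
have [h hE fh] := transport_exists f cx erefl erefl.
have [h' hE' fh'] := transport_exists f' cx erefl erefl.
have I0 := @unit_interval0 R; have I1 := @unit_interval1 R.
apply: (homotopic_trans fh); apply: homotopic_trans (homotopic_sym fh').
exists (fun z => collar (fun t => F (z.1, t)) (fun r => N (z.1, r)) 1 z.2); split.
- apply: (@collar_within R _ T n (unit_interval `*` cube n)
    snd (fun=> 1) (fun z => F (z.1.1, z.2)) (fun z => N (z.1.1, z.2))).
  + exact: snd_continuous.
  + exact: cst_continuous.
  + by move=> z [].
  + by [].
  + apply: (within_comp (k := fun z : (R * 'rV[R]_n) * 'rV[R]_n =>
      (z.1.1, z.2) : R * 'rV[R]_n) _ _ cF); last by move=> z [[]].
    apply: pair_continuous; last exact: snd_continuous.
    by move=> z; apply: (@continuous_comp _ _ _ fst fst); exact: fst_continuous.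
  + apply: (within_comp (k := fun z : (R * 'rV[R]_n) * R =>
      (z.1.1, z.2) : R * R) _ _ cN); last by move=> z [[]].
    apply: pair_continuous; last exact: snd_continuous.
    by move=> z; apply: (@continuous_comp _ _ _ fst fst); exact: fst_continuous.
  + by move=> [s t0] t [/= sI _] bt; exact: Fb.
- by move=> t ct; rewrite hE; apply: collar_eq => // r rI; rewrite N0.
- by move=> t ct; rewrite hE'; apply: collar_eq => // r rI; rewrite N1.
- move=> s t sI bt /=; rewrite collar_boundary ?Nx //.
  by move=> t' bt'; exact: Fb.
Qed.

(** Go from [f] to [f'] along [c], then to [g'] at rest, then backwards along [c]
    to [g]: the boundary traverses the loop [c \o phi], where [phi] rises from [0]
    to [1], rests, and returns. Scaling [phi] down to [0] contracts the loop. *)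
Lemma free_homotopic_homotopic (c : R -> T) n x x'
    (f g : based_map R n x) (f' g' : based_map R n x') :
  {within unit_interval, continuous c} -> c 0 = x -> c 1 = x' ->
  free_homotopic c f f' -> free_homotopic c g g' ->
  homotopic f' g' -> homotopic f g.
Proof.
move=> cc c0 c1 ff gg /homotopic_free fg.
have gg' := free_homotopic_sym gg.
(* [phi] rises up to the time [1/4], rests up to [1/2], and returns: the first
   two stages are joined before the third, so they share the first half. *)
pose phi s : R := Num.min (Num.min (4 * s + 0) (0 * s + 1)) (- 2 * s + 2).
have cphi : continuous phi.
  apply: Defs.min_continuous; last exact: affine_continuous.
  by apply: Defs.min_continuous; exact: affine_continuous.
have phiI s : unit_interval s -> unit_interval (phi s).
  by rewrite /phi /unit_interval /Num.min /=; do 2!case: ifP; lra.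
have fg1 : free_homotopic (c \o phi) f g.
  apply: (free_homotopic_trans (c := fun s => c (Num.min 1 (2 * s))) _ _ _ gg').
  - move=> s sI s2 /=; congr c; move: sI s2.
    by rewrite /phi /unit_interval /Num.min /=; do 3!case: ifP; lra.
  - move=> s sI s2 /=; congr c; move: sI s2.
    by rewrite /phi /unit_interval /Num.min /=; do 2!case: ifP; lra.
  apply: (free_homotopic_trans _ _ ff fg).
  - move=> s sI s2 /=; congr c; move: sI s2.
    by rewrite /unit_interval /Num.min /=; case: ifP; lra.
  - move=> s sI s2 /=; rewrite -c1; congr c; move: sI s2.
    by rewrite /unit_interval /Num.min /=; case: ifP; lra.
apply: (@free_homotopic_loop_homotopic n x
  (fun z => c ((1 - z.2) * phi z.1)) f g).
- apply: (within_comp (k := fun z : R * R => (1 - z.2) * phi z.1) _ _ cc).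
    move=> z; apply: cvgM.
      exact: (onem_continuous (@snd_continuous R R)).
    apply: (@continuous_comp _ _ _ fst phi); first exact: fst_continuous.
    exact: cphi.
  move=> [s r] [/= /phiI + +]; rewrite /unit_interval /= => h1 h2.
  by apply/andP; split; nra.
- by move=> s sI; rewrite /= subrr mul0r.
- by move=> r rI /=; rewrite -c0; congr c; rewrite /phi /Num.min; do 2!case: ifP; nra.
- by move=> r rI /=; rewrite -c0; congr c; rewrite /phi /Num.min; do 2!case: ifP; nra.
- move: fg1 => [F [cF F0 F1 Fb]]; exists F; split => // s t sI bt.
  by rewrite Fb //= subr0 mul1r.
Qed.

(** The relation is to be freely homotopic along [c]. *)
Lemma base_change n (c : R -> T) (x x' : T) :
  {within unit_interval, continuous c} -> c 0 = x -> c 1 = x' ->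
  group_isomorphic (homotopy_group R n.+1 x) (homotopy_group R n.+1 x').
Proof.
move=> cc c0 c1.
have cc' : {within unit_interval, continuous (fun s => c (1 - s))}.
  apply: (within_comp (k := fun s : R => 1 - s) _ _ cc).
    by apply: onem_continuous => s; exact: cvg_id.
  by move=> s; rewrite /unit_interval /=; lra.
have c0' : c (1 - 0) = x' by rewrite subr0.
have c1' : c (1 - 1) = x by rewrite subrr.
apply: (homotopy_group_iso_rel (Rel := fun f f' => free_homotopic c f f')).
- by move=> f; have [f' _ ff'] := transport_exists f cc c0 c1; exists f'.
- move=> f'; have [f _ ff'] := transport_exists f' cc' c0' c1'; exists f.
  have [F [cF F0 F1 Fb]] := free_homotopic_sym ff'; exists F; split => // s t sI bt.
  by rewrite Fb //; congr c; ring.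
- move=> f g f' g' ff' gg'; split; last first.
    exact: (free_homotopic_homotopic cc c0 c1 ff' gg').
  exact: (free_homotopic_homotopic cc' c0' c1'
    (free_homotopic_sym ff') (free_homotopic_sym gg')).
- by move=> f g f' g'; exact: free_homotopic_concat.
Qed.

End free_homotopy.

(** * Orbit maps as coverings *)

Section orbit_coverings.
Context {G : groupType} {T : topologicalType} (a : left_action G T).

Lemma orbit_mapP s t : orbit_map a s = orbit_map a t <-> exists g, a g s = t.
Proof. by split=> [/eqquotP/asboolP //|st]; apply/eqquotP/asboolP. Qed.

Lemma orbit_map_act g t : orbit_map a (a g t) = orbit_map a t.
Proof. by apply/esym/orbit_mapP; exists g. Qed.

Lemma orbit_map_surj b : exists t, orbit_map a t = b.
Proof. by exists (repr b); rewrite /orbit_map reprK. Qed.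

Lemma orbit_map_continuous : continuous (orbit_map a).
Proof. exact: pi_continuous. Qed.

Lemma lactK g : cancel (a g) (a (g^-1)%g).
Proof. by move=> t; rewrite -lactM mulVg lact1. Qed.

Lemma lactVK g : cancel (a (g^-1)%g) (a g).
Proof. by move=> t; rewrite -lactM mulgV lact1. Qed.

Lemma orbit_map_image_preimage (V : set T) :
  orbit_map a @^-1` (orbit_map a @` V) = \bigcup_g (a (g^-1)%g @^-1` V).
Proof.
apply/seteqP; split=> [t [v Vv /orbit_mapP[g <-]]|t [g _ Vt]].
  by exists g => //=; rewrite lactK.
by exists (a (g^-1)%g t) => //; rewrite orbit_map_act.
Qed.

Lemma orbit_map_open (V : set T) : open V -> open (orbit_map a @` V).
Proof.
move=> oV; suff : open (orbit_map a @^-1` (orbit_map a @` V)) by [].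
rewrite orbit_map_image_preimage; apply: bigcup_open => g _.
by apply: open_comp oV => t _; exact: lact_continuous.
Qed.

Lemma covering_regular : covering (orbit_map a) -> regular_covering (orbit_map a).
Proof.
move=> cov; split=> // e e' /orbit_mapP[g ge]; exists (a g) => //; split.
- exact: lact_continuous.
- exists (a (g^-1)%g).
  by split; [exact: lact_continuous | exact: lactK | exact: lactVK].
- exact: orbit_map_act.
Qed.

(** The translates [g V], for distinct [g], are disjoint: this is the local form
    of proper discontinuity, which passes to products. *)
Definition wandering := forall t : T, exists2 V, nbhs t V &
  forall g v, V v -> V (a g v) -> g = 1%g.

(** The orbit map is injective on a sheet, so a sheet cannot meet one of its
    translates unless some point is fixed. *)
Lemma properly_discontinuous_wandering :
  properly_discontinuous a -> wandering.
Proof.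
move=> [fr [_ _ ev]] t; have [U [oU Ut [J [V [oV _ pU hV]]]]] := ev (orbit_map a t).
have [i _ Vt] : (\bigcup_i V i) t by rewrite -pU.
exists (V i); first exact: open_nbhs_nbhs.
move=> g v Vv Vgv; have [sg [_ _ sgK _]] := hV i.
by apply: (fr _ v); rewrite -(sgK _ Vgv).2 orbit_map_act (sgK _ Vv).2.
Qed.

Lemma wandering_free : wandering -> free_action a.
Proof.
move=> wa g t gt; have [V Vt hV] := wa t.
by apply: (hV g t); rewrite ?gt; exact: nbhs_singleton.
Qed.

(** The sheets over the image of an open wandering set are its translates. *)
Lemma wandering_covering : wandering -> covering (orbit_map a).
Proof.
move=> wa; split; [exact: orbit_map_continuous | exact: orbit_map_surj |].
move=> b; have [t <-] := orbit_map_surj b.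
have [V0 V0t hV0] := wa t.
pose V := interior V0; have oV : open V by exact: open_interior.
have VV0 : V `<=` V0 by exact: interior_subset.
have hV g v : V v -> V (a g v) -> g = 1%g by move=> /VV0 + /VV0; exact: hV0.
exists (orbit_map a @` V); split.
- exact: orbit_map_open.
- by exists t => //; exact: V0t.
exists G, (fun g => a (g^-1)%g @^-1` V); split.
- by move=> g; apply: open_comp oV => u _; exact: lact_continuous.
- move=> g h _ _ [u [/= Vg Vh]].
  have := hV (h^-1 * g)%g _ Vg; rewrite lactM lactVK => /(_ Vh) hg.
  by apply: (@mulgI _ (h^-1)%g); rewrite hg mulVg.
- exact: orbit_map_image_preimage.
move=> g.
have hs b' : exists u, (orbit_map a @` V) b' ->
    V (a (g^-1)%g u) /\ orbit_map a u = b'.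
  have [[v Vv vb]|nb] := pselect ((orbit_map a @` V) b'); last by exists t.
  by exists (a g v) => _; rewrite lactK orbit_map_act.
have [s sP] := choice hs.
have sK u : V (a (g^-1)%g u) -> s (orbit_map a u) = u.
  move=> Vu; have Ub : (orbit_map a @` V) (orbit_map a u).
    by exists (a (g^-1)%g u) => //; rewrite orbit_map_act.
  have [Vs /orbit_mapP[h hsu]] := sP _ Ub.
  have h1 : (g^-1 * h * g)%g = 1%g.
    by apply: (hV _ _ Vs); rewrite 2!lactM lactVK hsu.
  have {}h1 : h = 1%g.
    by apply: (@mulgI _ (g^-1)%g); apply: (@mulIg _ g); rewrite h1 mulg1 mulVg.
  by rewrite -[RHS]hsu h1 lact1.
exists s; split.
- by apply: continuous_subspaceT; exact: orbit_map_continuous.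
- apply/withinP => b' Ub' W Ws.
  have [Vs sb] := sP _ Ub'.
  pose O := interior W `&` (a (g^-1)%g @^-1` V).
  have oO : open O.
    apply: openI; first exact: open_interior.
    by apply: open_comp oV => u _; exact: lact_continuous.
  have : nbhs b' (orbit_map a @` O).
    by apply: open_nbhs_nbhs; split; [exact: orbit_map_open | exists (s b')].
  apply: filterS => _ [u [Wu Vu] <-] _; rewrite sK //.
  exact: interior_subset.
- move=> u Vu; split; last exact: sK.
  by exists (a (g^-1)%g u) => //; rewrite orbit_map_act.
- by move=> b' /sP[].
Qed.

End orbit_coverings.

(** * Lifting based maps and loops *)

Section lifting_homotopies.
Context {R : realType} {E B : topologicalType} {p : E -> B}.
Hypothesis cov : covering p.

Lemma cube_boundary0 n : cube_boundary (0 : 'rV[R]_n.+1).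
Proof. by split; [exact: cube0 | exists ord0; left; rewrite mxE]. Qed.

(** Lift the homotopy from the common origin of [l] and [l']. By uniqueness it
    starts with [l]; the boundary is at rest below, hence also above; so the last
    stage has the origin of [l'], and is [l']. In particular the end points of
    lifts of loops only depend on the homotopy class. *)
Lemma lift_homotopy n b (f g : based_map R n.+1 b) (l l' : 'rV[R]_n.+1 -> E) :
  {within cube n.+1, continuous l} -> (forall t, cube n.+1 t -> p (l t) = f t) ->
  {within cube n.+1, continuous l'} -> (forall t, cube n.+1 t -> p (l' t) = g t) ->
  l 0 = l' 0 -> homotopic f g ->
  exists L : R * 'rV[R]_n.+1 -> E,
    [/\ {within unit_interval `*` cube n.+1, continuous L},
        forall t, cube n.+1 t -> L (0, t) = l t,
        forall t, cube n.+1 t -> L (1, t) = l' t &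
        forall s t, unit_interval s -> cube_boundary t -> L (s, t) = l t].
Proof.
move=> cl pl cl' pl' ll' [F [cF F0 F1 Fb]].
have I0 := @unit_interval0 R; have I1 := @unit_interval1 R.
have c0 : cube n.+1 (0 : 'rV[R]_n.+1) by exact: cube0.
have pl0 : p (l 0) = F (0, 0) by rewrite pl // F0.
have [L [cL pL L0]] :=
  lift_exists cov (cylinder_contracts n.+1) (conj I0 c0) cF pl0.
have cLs s : unit_interval s -> {within cube n.+1, continuous (fun t => L (s, t))}.
  move=> sI.
  apply: (within_comp (k := fun t => (s, t) : R * 'rV[R]_n.+1) _ _ cL) => //.
  by apply: pair_continuous; [exact: cst_continuous | move=> t; exact: cvg_id].
have L0E t : cube n.+1 t -> L (0, t) = l t.
  move=> ct.
  apply: (lift_unique cov (cube_contracts n.+1) (cLs 0 I0) cl _ L0 ct) => t' ct'.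
  by rewrite pL //= F0 // pl.
have Lb s t : unit_interval s -> cube_boundary t -> L (s, t) = l t.
  move=> sI bt; rewrite -(L0E t bt.1).
  have rI r : unit_interval r -> unit_interval (r * s).
    by move: sI; rewrite /unit_interval /= => *; apply/andP; split; nra.
  have := @lift_constant_along R _ _ _ p _ L (fun r => (r * s, t)) b cov cL.
  rewrite /= mul1r mul0r; apply.
  - apply: pair_continuous => r; last exact: cvg_cst.
    by apply: cvgM; [exact: cvg_id | exact: cvg_cst].
  - by move=> r /rI ?; split => //; exact: bt.1.
  - by move=> r /rI ?; rewrite pL ?Fb //; split => //; exact: bt.1.
exists L; split => // t ct.
apply: (lift_unique cov (cube_contracts n.+1) (cLs 1 I1) cl' _ _ ct).
- by move=> t' ct'; rewrite pL //= F1 // pl'.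
- by rewrite -ll'; apply: Lb => //; exact: cube_boundary0.
Qed.

(** From dimension [2] on, the boundary of the cube is connected: a point of
    the face [t_i = 0 or 1] slides inside this face to its corner on the [i]-th
    axis, and then along this axis, which lies in the face where another
    coordinate vanishes. *)
Lemma lift_constant_boundary n b e (f : based_map R n.+2 b) (l : 'rV[R]_n.+2 -> E) :
  {within cube n.+2, continuous l} -> (forall t, cube n.+2 t -> p (l t) = f t) ->
  l 0 = e -> forall t, cube_boundary t -> l t = e.
Proof.
move=> cl pl l0 t [ct [i ti]].
have along (c : R -> 'rV[R]_n.+2) : continuous c ->
    (forall s, unit_interval s -> cube_boundary (c s)) -> l (c 1) = l (c 0).
  move=> cc cb; apply: (lift_constant_along (b := b) cov cl cc).
    by move=> s /cb[].
  by move=> s /cb bc; rewrite pl ?based_boundary //; exact: bc.1.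
pose c1 (s : R) : 'rV[R]_n.+2 := \row_j (if j == i then t ord0 i else s * t ord0 j).
pose c2 (s : R) : 'rV[R]_n.+2 := \row_j (if j == i then s * t ord0 i else 0).
have cM (u : R) : continuous (fun s : R => s * u).
  by move=> s; apply: cvgM; [exact: cvg_id | exact: cvg_cst].
have cb s : unit_interval s -> forall j, unit_interval (s * t ord0 j).
  move=> sI j; move: (ct j) sI; rewrite /unit_interval /= => *.
  by apply/andP; split; nra.
have e1 : l t = l (c1 0).
  transitivity (l (c1 1)).
    by congr l; apply/rowP => j; rewrite mxE mul1r; case: eqP => // ->.
  apply: along.
    apply: row_continuous => j; rewrite [X in continuous X](_ : _ =
      fun s => if j == i then t ord0 i else s * t ord0 j); last first.
      by apply/funext => s; rewrite mxE.
    by case: eqP => _; [exact: cst_continuous | exact: cM].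
  move=> s sI; split; last by exists i; rewrite mxE eqxx.
  by move=> j; rewrite mxE; case: eqP => _; [exact: ct | exact: cb].
have e2 : l (c2 1) = l (c2 0).
  apply: along.
    apply: row_continuous => j; rewrite [X in continuous X](_ : _ =
      fun s => if j == i then s * t ord0 i else 0); last first.
      by apply/funext => s; rewrite mxE.
    by case: eqP => _; [exact: cM | exact: cst_continuous].
  move=> s sI; split.
    by move=> j; rewrite mxE; case: eqP => _; [exact: cb | exact: unit_interval0].
  exists (lift i ord0); left.
  by rewrite mxE ifF // eq_sym; apply/negbTE/neq_lift.
rewrite e1 (_ : c1 0 = c2 1); last first.
  by apply/rowP => j; rewrite !mxE; case: eqP; rewrite ?mul1r ?mul0r.
by rewrite e2 -l0; congr l; apply/rowP => j; rewrite !mxE mul0r; case: ifP.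
Qed.

(** A based map below is related to its lift, which is based because the lift is
    constant on the boundary. *)
Lemma covering_higher_homotopy n (e : E) :
  group_isomorphic (homotopy_group R n.+2 (p e)) (homotopy_group R n.+2 e).
Proof.
have cp : continuous p by case: cov.
have h0 (f : based_map R n.+2 e) : f 0 = e.
  by apply: based_boundary; exact: cube_boundary0.
apply: (homotopy_group_iso_rel (Rel := fun (f : based_map R n.+2 (p e)) f' =>
  forall t, cube n.+2 t -> p (f' t) = f t)).
- move=> f.
  have fe : p e = f 0 by rewrite based_boundary //; exact: cube_boundary0.
  have [l [cl pl l0]] := lift_exists cov (cube_contracts n.+2)
    (@cube0 R n.+2) (based_continuous f) fe.
  by exists (BasedMap cl (lift_constant_boundary cl pl l0)).
- by move=> f; exists (push cp f).
- move=> f g f' g' ff gg; split.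
    move=> /(lift_homotopy (based_continuous f') ff (based_continuous g') gg).
    rewrite !h0 => /(_ erefl)[L [cL L0 L1 Lb]]; exists L; split => // s t sI bt.
    by rewrite Lb // based_boundary.
  move=> /(push_homotopic cp) h.
  apply: (homotopic_trans (homotopic_trans _ h)); apply: homotopic_eq => t ct /=.
    by rewrite ff.
  by rewrite gg.
- move=> f g f' g' ff gg t ct /=.
  have := @push_concat R E B p cp n.+1 e f' g' t => /= ->.
  by have /= -> // := concat_eq (f' := f) (g' := g)
    (f := push cp f') (g := push cp g') _ _ ct.
Qed.

End lifting_homotopies.

Section loops.
Context {R : realType}.

Lemma cube1_boundary (t : 'rV[R]_1) :
  cube_boundary t <-> t = const_mx 0 \/ t = const_mx 1.
Proof.
split=> [[ct [i]]|]; rewrite ?(ord1 i).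
  by case=> t0; [left | right]; apply/rowP => j; rewrite (ord1 j) t0 mxE.
have I0 := @unit_interval0 R; have I1 := @unit_interval1 R.
by case=> ->; split; (try by move=> i; rewrite mxE); exists ord0;
  rewrite mxE; [left | right].
Qed.

Lemma set_first_const (t : 'rV[R]_1) s : set_first t s = const_mx s.
Proof. by apply/rowP => i; rewrite (ord1 i) set_first0 mxE. Qed.

Lemma cube_const n (s : R) : unit_interval s -> cube n (const_mx s : 'rV[R]_n).
Proof. by move=> sI i; rewrite mxE. Qed.

Lemma concat_path_within (T : topologicalType) (f g : 'rV[R]_1 -> T) :
  {within cube 1, continuous f} -> {within cube 1, continuous g} ->
  f (const_mx 1) = g (const_mx 0) -> {within cube 1, continuous (concat_fun f g)}.
Proof.
move=> cf cg fg.
have cid : continuous (fun t : 'rV[R]_1 => t) by move=> t; exact: cvg_id.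
have c0 : continuous (fun t : 'rV[R]_1 => t ord0 ord0) by exact: first_continuous.
have c1 := double_sub1_continuous c0.
have c2 := double_continuous c0.
apply: within_if; first exact: c0.
- apply: (within_comp _ _ cf); first exact: (set_first_continuous cid c2).
  move=> t [ct t0]; apply: set_first_cube => //.
  by move: (ct ord0) t0; rewrite /unit_interval /=; lra.
- apply: (within_comp _ _ cg); first exact: (set_first_continuous cid c1).
  move=> t [ct t0]; apply: set_first_cube => //.
  by move: (ct ord0) t0; rewrite /unit_interval /=; lra.
- by move=> t ct ->; rewrite !set_first_const mulfV ?pnatr_eq0 // subrr.
Qed.

Lemma concat_fun0 (T : topologicalType) (f g : 'rV[R]_1 -> T) :
  concat_fun f g (const_mx 0) = f (const_mx 0).
Proof. by rewrite /concat_fun !set_first_const mxE mulr0 ifT // invr_ge0. Qed.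

Lemma concat_fun1 (T : topologicalType) (f g : 'rV[R]_1 -> T) :
  concat_fun f g (const_mx 1) = g (const_mx 1).
Proof.
rewrite /concat_fun !set_first_const mxE ifF; last by apply/negbTE; lra.
by congr (g (const_mx _)); ring.
Qed.

Context {E B : topologicalType} {p : E -> B}.

Lemma lift_concat b (f g : based_map R 1 b) (l l' : 'rV[R]_1 -> E) :
  is_lift p f l -> is_lift p g l' -> l (const_mx 1) = l' (const_mx 0) ->
  is_lift p (concat f g) (concat_fun l l').
Proof.
move=> [cl pl] [cl' pl'] ll'; split; first exact: concat_path_within.
move=> t ct; have := ct ord0; rewrite /= /concat_fun /unit_interval /=.
by case: ifPn => t0 t01; [apply: pl | apply: pl'];
  apply: set_first_cube => //; rewrite /unit_interval /=; lra.
Qed.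

Lemma is_lift_based (l : 'rV[R]_1 -> E) b :
  continuous p -> {within cube 1, continuous l} ->
  p (l (const_mx 0)) = b -> p (l (const_mx 1)) = b ->
  exists f : based_map R 1 b, is_lift p f l.
Proof.
move=> cp cl l0 l1.
have cf : {within cube 1, continuous (p \o l)}.
  exact: continuous_comp_within.
have fb t : cube_boundary t -> (p \o l) t = b by move=> /cube1_boundary[] ->.
by exists (BasedMap cf fb).
Qed.

Lemma loop_lift e (f : based_map R 1 (p e)) : covering p ->
  exists2 l, is_lift p f l & l (const_mx 0) = e.
Proof.
move=> cov.
have fe : p e = f 0 by rewrite based_boundary //; exact: cube_boundary0.
have [l [cl pl l0]] := lift_exists cov (cube_contracts 1)
  (@cube0 R 1) (based_continuous f) fe.
by exists l.
Qed.

End loops.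

Lemma is_lift_act (R : realType) (G : groupType) (T : topologicalType)
    (a : left_action G T) (f : 'rV[R]_1 -> orbit_space a) l g :
  is_lift (orbit_map a) f l -> is_lift (orbit_map a) f (a g \o l).
Proof.
move=> [cl pl]; split; last by move=> t ct; rewrite /= orbit_map_act pl.
by apply: continuous_comp_within cl; exact: lact_continuous.
Qed.

Lemma lift_end (R : realType) (G : groupType) (T : topologicalType)
    (a : left_action G T) x (f : based_map R 1 (orbit_map a x)) l :
  is_lift (orbit_map a) f l -> exists g, l (const_mx 1) = a g x.
Proof.
move=> [_ pl]; have I1 := @unit_interval1 R.
have : orbit_map a x = orbit_map a (l (const_mx 1)).
  rewrite pl; last exact: cube_const.
  by rewrite based_boundary //; apply/cube1_boundary; right.
by move=> /orbit_mapP[g <-]; exists g.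
Qed.

(** The lift of [concat f g] continues the lift of [f], which ends at [h y], with
    the lift of [g] translated by [h]: if the latter ends at [k y], the result
    ends at [h k y]. *)
Lemma boundary_homomorphism (R : realType) (H : groupType) (Y : topologicalType)
    (a : left_action H Y) (y : Y) :
  free_action a -> covering (orbit_map a) ->
  exists d : UMagmaMorphism.type (homotopy_group R 1 (orbit_map a y)) H,
    is_boundary d.
Proof.
move=> fr cov.
have frI g h z : a g z = a h z -> g = h.
  move=> gh; apply: (@mulgI _ (h^-1)%g); rewrite mulVg; apply: (fr _ z).
  by rewrite lactM gh lactK.
pose rel (f : based_map R 1 (orbit_map a y)) h :=
  exists l, [/\ is_lift (orbit_map a) f l, l (const_mx 0) = y &
                l (const_mx 1) = a h y].
have relT f : exists h, rel f h.
  have [l lf l0] := loop_lift f cov; have [h l1] := lift_end lf.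
  by exists h, l.
have relU f g h k : homotopic f g -> rel f h -> rel g k -> h = k.
  move=> fg [l [[cl pl] l0 l1]] [l' [[cl' pl'] l0' l1']]; apply: (frI _ _ y).
  rewrite -l1 -l1'.
  have [L [_ L0 L1 Lb]] :=
    lift_homotopy cov cl pl cl' pl' (etrans l0 (esym l0')) fg.
  have I1 := @unit_interval1 R.
  rewrite -L1; last exact: cube_const.
  by rewrite Lb //; apply/cube1_boundary; right.
have [phi phiP] := choice relT.
pose d (c : homotopy_group R 1 (orbit_map a y)) := phi (repr c).
have dE f h : rel f h -> d (homotopy_class f) = h.
  by apply: relU (phiP _); exact: repr_homotopic.
have dM : {morph d : b c / (b * c)%g}.
  move=> b c; have [f ->] := homotopy_class_surj b.
  have [g ->] := homotopy_class_surj c.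
  have -> : (homotopy_class f * homotopy_class g)%g = homotopy_class (concat f g).
    exact: homotopy_mulE.
  rewrite (dE _ _ (phiP f)) (dE _ _ (phiP g)); apply: dE.
  have [l [lf l0 l1]] := phiP f; have [l' [lg l0' l1']] := phiP g.
  exists (concat_fun l (a (phi f) \o l')); split.
  - apply: lift_concat => //; first exact: is_lift_act.
    by rewrite /= l1 l0'.
  - by rewrite concat_fun0.
  - by rewrite concat_fun1 /= l1' lactM.
have d1 : d 1%g = 1%g by apply: (@mulgI H (d 1%g)); rewrite -dM !mulg1.
pose D := HB.pack_for (UMagmaMorphism.type (homotopy_group R 1 (orbit_map a y)) H) d
  (isUMagmaMorphism.Build _ H d (conj d1 dM)).
exists D => f; split.
  by have [l lf l0] := loop_lift f cov; exists l.
move=> l lf l0; have [h l1] := lift_end lf.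
by rewrite l1; congr (a _ y); apply/esym/dE; exists l.
Qed.

(** * The wreath product action *)

Lemma within_ptws (Z : topologicalType) (I : Type) (T : topologicalType)
    (A : set Z) (f : Z -> {ptws I -> T}) :
  (forall i, {within A, continuous (fun z => f z i)}) -> {within A, continuous f}.
Proof.
move=> cf; apply/withinP => z Az W fW.
suff : f @ within A (nbhs z) --> f z by move=> /(_ W fW).
apply/cvg_sup => i U [_ [[V oV <-] Vz VU]].
move/withinP: (cf i) => /(_ z Az V (open_nbhs_nbhs (conj oV Vz))).
by apply: filterS => w Vw Aw; exact: VU (Vw Aw).
Qed.

Lemma dep_choice (I : Type) (U : I -> Type) (P : forall i, U i -> Prop) :
  (forall i, exists u, P i u) -> exists f : forall i, U i, forall i, P i (f i).
Proof.
by move=> h; exists (fun i => sval (cid (h i))) => i; exact: svalP (cid (h i)).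
Qed.

Section wreath.
Context {R : realType} {G : groupType} {H : finGroupType} {X Y : topologicalType}.
Variables (aG : left_action G X) (aH : left_action H Y).

Local Notation W := (wreath_space H X Y).
Local Notation aW := (wreath_action aG aH).

Lemma coordinate_continuous (k : H) : continuous (fun w : W => w.1 k).
Proof.
move=> w; apply: (@continuous_comp _ _ _ fst (fun f : {ptws H -> X} => f k)).
  exact: fst_continuous.
exact: ptws_eval_continuous.
Qed.

Lemma wreath_space_within (Z : topologicalType) (A : set Z)
    (f : H -> Z -> X) (g : Z -> Y) :
  (forall k, {within A, continuous (f k)}) -> {within A, continuous g} ->
  {within A, continuous (fun z => (fun k => f k z, g z) : W)}.
Proof.
move=> cf cg.
apply: (@within_pair Z {ptws H -> X} Y A (fun z k => f k z) g) => //.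
by apply: within_ptws => k; exact: cf.
Qed.

Lemma coordinate_within (Z : topologicalType) (A : set Z) (l : Z -> W) k :
  {within A, continuous l} -> {within A, continuous (fun z => (l z).1 k)}.
Proof.
exact: continuous_comp_within (@coordinate_continuous k).
Qed.

Lemma last_within (Z : topologicalType) (A : set Z) (l : Z -> W) :
  {within A, continuous l} -> {within A, continuous (fun z => (l z).2)}.
Proof.
exact: continuous_comp_within (@snd_continuous {ptws H -> X} Y).
Qed.

Lemma wreath_path_connected :
  path_connected R X -> path_connected R Y -> path_connected R W.
Proof.
move=> pX pY w w'; have [c hc] := choice (fun k => pX (w.1 k) (w'.1 k)).
have [e [ce e0 e1]] := pY w.2 w'.2.
exists (fun s => (fun k => c k s, e s)); split.
- by apply: wreath_space_within => // k; case: (hc k).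
- case: w c hc e e0 e1 ce => u y /= c hc e -> _ _; congr (_, _).
  by apply/funext => k; case: (hc k).
- case: w' c hc e e0 e1 ce => u y /= c hc e _ -> _; congr (_, _).
  by apply/funext => k; case: (hc k).
Qed.

(** The factor in [Y] forces the second component to be [1]; only then does the
    action preserve each coordinate of the box, and the factors in [X] take care
    of the first component. *)
Lemma wreath_wandering : wandering aG -> wandering aH -> wandering aW.
Proof.
move=> wG wH [f y].
have [V hV] := choice (fun k => let: ex_intro2 V a b := wG (f k) in
  ex_intro (fun V => nbhs (f k) V /\ forall g v, V v -> V (aG g v) -> g = 1%g)
    V (conj a b)).
have [U Uy hU] := wH y.
exists [set w : W | (forall k, V k (w.1 k)) /\ U w.2].
  have hVf : \forall w \near ((f, y) : W), forall k, V k (w.1 k).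
    apply: (@filter_forall W H (fun k w => V k (w.1 k)) (nbhs ((f, y) : W))) => k.
    apply: (@coordinate_continuous k (f, y) (V k)).
    by case: (hV k).
  apply: filterI hVf _.
  exact: (@snd_continuous {ptws H -> X} Y (f, y) _ Uy).
move=> [phi h] [u z] /= [Vu Uz] [Vu' Uz'].
have h1 : h = 1%g := hU _ _ Uz Uz'; rewrite h1 in Vu' *.
congr (_, _); apply/funext => k; apply: (hV k).2 (Vu k) _.
by have := Vu' k; rewrite /= mulg1.
Qed.

Section fundamental_group.
Variables (x : X) (y : Y).
Let w0 : W := (fun=> x, y).
Hypotheses (freeH : free_action aH).
Hypotheses (covG : covering (orbit_map aG)) (covH : covering (orbit_map aH)).
Hypothesis (covW : covering (orbit_map aW)).
Variable d : UMagmaMorphism.type (homotopy_group R 1 (orbit_map aH y)) H.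
Hypothesis dP : is_boundary d.

Local Notation loopX := (based_map R 1 (orbit_map aG x)).
Local Notation loopY := (based_map R 1 (orbit_map aH y)).
Local Notation loopW := (based_map R 1 (orbit_map aW w0)).

(** The relation behind the isomorphism of fundamental groups: [f] and [b]
    represent the two components of the image of [gamma]. *)
Definition lifts_to (gamma : loopW) (f : H -> loopX) (b : loopY)
    (l : 'rV[R]_1 -> W) :=
  [/\ is_lift (orbit_map aW) gamma l, l (const_mx 0) = w0,
      forall k, is_lift (orbit_map aG) (f k) (fun t => (l t).1 k) &
      is_lift (orbit_map aH) b (fun t => (l t).2)].

Lemma lifts_to_exists gamma : exists f b l, lifts_to gamma f b l.
Proof.
have [l [cl pl] l0] := loop_lift gamma covW.
have [[phi h] l1] := lift_end (conj cl pl).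
have hf k : exists f : loopX, is_lift (orbit_map aG) f (fun t => (l t).1 k).
  apply: is_lift_based; first exact: orbit_map_continuous.
  - exact: coordinate_within.
  - by rewrite l0.
  - by rewrite l1 /= orbit_map_act.
have [f fP] := choice hf.
have [b bP] : exists b : loopY, is_lift (orbit_map aH) b (fun t => (l t).2).
  apply: is_lift_based; first exact: orbit_map_continuous.
  - exact: last_within.
  - by rewrite l0.
  - by rewrite l1 /= orbit_map_act.
by exists f, b, l.
Qed.

(** The lifts of the given loops end in the orbits of [x] and [y]. As all
    coordinates of [w0] in [X] are equal, permuting them has no effect, and the
    assembled path ends in the orbit of [w0]. *)
Lemma lifts_to_assemble (f : H -> loopX) (b : loopY) :
  exists gamma l, lifts_to gamma f b l.
Proof.
have [lX lXP] := choice (fun k => let: ex_intro2 l a b := loop_lift (f k) covG in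
  ex_intro (fun l => is_lift (orbit_map aG) (f k) l /\ l (const_mx 0) = x)
    l (conj a b)).
have [lY lYP lY0] := loop_lift b covH.
pose l (t : 'rV[R]_1) : W := (fun k => lX k t, lY t).
have [g gP] := choice (fun k => lift_end (lXP k).1).
have [h hP] := lift_end lYP.
have l0 : l (const_mx 0) = w0.
  by rewrite /l lY0; congr (_, _); apply/funext => k; case: (lXP k).
have l1 : l (const_mx 1) = aW (g, h) w0.
  by rewrite /l hP; congr (_, _); apply/funext => k; rewrite gP.
have [gamma gammaP] : exists gamma : loopW, is_lift (orbit_map aW) gamma l.
  apply: is_lift_based; first exact: orbit_map_continuous.
  - apply: wreath_space_within; last by case: lYP.
    by move=> k; case: (lXP k) => [[]].
  - by rewrite l0.
  - by rewrite l1 orbit_map_act.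
by exists gamma, l; split => // k; case: (lXP k).
Qed.

(** A homotopy of [gamma] lifts to the wreath space, where its coordinates project
    to homotopies of the [f k] and of [b]; conversely, lifts of the latter
    homotopies are the coordinates of a homotopy that projects to one of
    [gamma]. *)
Lemma lifts_to_homotopic gamma gamma' f f' b b' l l' :
  lifts_to gamma f b l -> lifts_to gamma' f' b' l' ->
  (homotopic gamma gamma' <->
   (forall k, homotopic (f k) (f' k)) /\ homotopic b b').
Proof.
move=> [[cl pl] l0 lf [clb lb]] [[cl' pl'] l0' lf' [clb' lb']].
split=> [|[hf hb]].
  move=> /(lift_homotopy covW cl pl cl' pl' (etrans l0 (esym l0'))).
  move=> [L [cL L0 L1 Lb]]; split.
    move=> k; exists (fun z => orbit_map aG ((L z).1 k)); split.
    - apply: continuous_comp_within; first exact: orbit_map_continuous.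
      exact: coordinate_within.
    - by move=> t ct; rewrite L0 // (lf k).2.
    - by move=> t ct; rewrite L1 // (lf' k).2.
    - by move=> s t sI bt; rewrite Lb // (lf k).2 ?based_boundary //; case: bt.
  exists (fun z => orbit_map aH (L z).2); split.
  - apply: continuous_comp_within; first exact: orbit_map_continuous.
    exact: last_within.
  - by move=> t ct; rewrite L0 // lb.
  - by move=> t ct; rewrite L1 // lb'.
  - by move=> s t sI bt; rewrite Lb // lb ?based_boundary //; case: bt.
have start k : (l 0).1 k = (l' 0).1 k.
  have -> : l 0 = w0 by rewrite -l0.
  by have -> : l' 0 = w0 by rewrite -l0'.
have startb : (l 0).2 = (l' 0).2.
  have -> : l 0 = w0 by rewrite -l0.
  by have -> : l' 0 = w0 by rewrite -l0'.
have [L LP] := choice (fun k => lift_homotopy covG (lf k).1 (lf k).2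
  (lf' k).1 (lf' k).2 (start k) (hf k)).
have [M [cM M0 M1 Mb]] := lift_homotopy covH clb lb clb' lb' startb hb.
exists (fun z => orbit_map aW (fun k => L k z, M z)); split.
- apply: (@continuous_comp_within _ _ _ _ (fun z => (fun k => L k z, M z) : W)).
    exact: orbit_map_continuous.
  by apply: wreath_space_within => // k; case: (LP k).
- move=> t ct; rewrite M0 // (_ : (fun k => L k (0, t)) = (l t).1).
    by rewrite -pl //; case: (l t).
  by apply/funext => k; case: (LP k) => _ -> .
- move=> t ct; rewrite M1 // (_ : (fun k => L k (1, t)) = (l' t).1).
    by rewrite -pl' //; case: (l' t).
  by apply/funext => k; case: (LP k) => _ _ -> .
- move=> s t sI bt; rewrite Mb // (_ : (fun k => L k (s, t)) = (l t).1).
    rewrite -(based_boundary gamma bt) -pl; last by case: bt.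
    by case: (l t).
  by apply/funext => k; case: (LP k) => _ _ _ -> .
Qed.

(** The second lift is translated by [(phi, h)], where [h] is the boundary of
    [b]: its [k]-th coordinate becomes [phi k] times the coordinate of index
    [k * h], and [phi k] does not change the projected loop. *)
Lemma lifts_to_concat gamma gamma' f f' b b' l l' :
  lifts_to gamma f b l -> lifts_to gamma' f' b' l' ->
  exists l'', lifts_to (concat gamma gamma')
    (fun k => concat (f k) (f' (k * d (homotopy_class b))%g)) (concat b b') l''.
Proof.
move=> [lg l0 lf lb] [lg' l0' lf' lb'].
have [[phi h] l1] := lift_end lg.
have hd : d (homotopy_class b) = h.
  have := (dP b).2 _ lb; rewrite l0 l1 /= => /(_ erefl) e.
  apply: (@mulgI _ (h^-1)%g); rewrite mulVg; apply: (@freeH _ y).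
  by rewrite lactM -e lactK.
rewrite hd.
pose l2 := aW (phi, h) \o l'.
have l12 : l (const_mx 1) = l2 (const_mx 0) by rewrite /l2 /= l0' l1.
exists (concat_fun l l2); split.
- by apply: lift_concat => //; exact: is_lift_act.
- by rewrite concat_fun0.
- move=> k.
  rewrite (_ : (fun t => _) =
    concat_fun (fun t => (l t).1 k) (fun t => (l2 t).1 k)).
    apply: lift_concat => //; last by rewrite l12.
    exact: (is_lift_act (phi k) (lf' (k * h)%g)).
  by apply/funext => t; rewrite /concat_fun; case: ifP.
- rewrite (_ : (fun t => _) = concat_fun (fun t => (l t).2) (fun t => (l2 t).2)).
    apply: lift_concat => //; last by rewrite l12.
    exact: (is_lift_act (h) lb').
  by apply/funext => t; rewrite /concat_fun; case: ifP.
Qed.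

Lemma fundamental_group_wreath :
  group_isomorphic (homotopy_group R 1 (orbit_map aW w0))
    (wreath_product (homotopy_group R 1 (orbit_map aG x)) d).
Proof.
apply: (homotopy_group_iso (Rel := fun gamma
  (v : wreath_product (homotopy_group R 1 (orbit_map aG x)) d) =>
  exists f b l, lifts_to gamma f b l /\
    v = (fun k => homotopy_class (f k), homotopy_class b))).
- move=> gamma; have [f [b [l lP]]] := lifts_to_exists gamma.
  by exists (fun k => homotopy_class (f k), homotopy_class b), f, b, l.
- move=> [u c]; have [f fP] := choice (fun k => homotopy_class_surj (u k)).
  have [b ->] := homotopy_class_surj c.
  have [gamma [l lP]] := lifts_to_assemble f b.
  exists gamma, f, b, l; split => //; congr (_, _).
  by apply/funext => k; rewrite fP.
- move=> gamma gamma' v v' [f [b [l [lP ->]]]] [f' [b' [l' [lP' ->]]]].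
  rewrite (lifts_to_homotopic lP lP'); split=> [[hf hb]|[] hf hb].
    congr (_, _); last exact/homotopy_classP.
    by apply/funext => k; exact/homotopy_classP.
  split; last exact/homotopy_classP.
  by move=> k; apply/homotopy_classP; move: hf => /(congr1 (@^~ k)).
- move=> gamma gamma' v v' [f [b [l [lP ->]]]] [f' [b' [l' [lP' ->]]]].
  have [l'' lP''] := lifts_to_concat lP lP'.
  exists (fun k => concat (f k) (f' (k * d (homotopy_class b))%g)), (concat b b').
  exists l''.
  split=> //; congr (_, _); last exact: homotopy_mulE.
  by apply/funext => k; exact: homotopy_mulE.
Qed.

End fundamental_group.

(** A based map into the product is the family of its coordinates, and so is a
    homotopy; each coordinate is moved from its own base point to [x] or [y]. *)
Lemma homotopy_group_product n (x : X) (y : Y) (w : W) :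
  path_connected R X -> path_connected R Y ->
  group_isomorphic (homotopy_group R n.+1 w)
    ({ffun 'I_#|H| -> homotopy_group R n.+1 x} * homotopy_group R n.+1 y)%type.
Proof.
move=> pX pY.
have eX (i : 'I_#|H|) : exists e : UMagmaMorphism.type
    (homotopy_group R n.+1 (w.1 (enum_val i))) (homotopy_group R n.+1 x),
    bijective e.
  have [c [cc c0 c1]] := pX (w.1 (enum_val i)) x.
  exact: base_change cc c0 c1.
have [e eP] := dep_choice eX.
have [c [cc c0 c1]] := pY w.2 y.
have [eY eYP] := base_change n cc c0 c1.
have csnd : continuous (@snd {ptws H -> X} Y) by exact: snd_continuous.
pose pushX (i : 'I_#|H|) (f : based_map R n.+1 w) :
    based_map R n.+1 (w.1 (enum_val i)) :=
  push (@coordinate_continuous (enum_val i)) f.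
pose pushY (f : based_map R n.+1 w) : based_map R n.+1 w.2 := push csnd f.
apply: (homotopy_group_iso (Rel := fun f
  (a : {ffun 'I_#|H| -> homotopy_group R n.+1 x} * homotopy_group R n.+1 y) =>
  (forall i, a.1 i = e i (homotopy_class (pushX i f))) /\
  a.2 = eY (homotopy_class (pushY f)))).
- move=> f; exists ([ffun i => e i (homotopy_class (pushX i f))],
    eY (homotopy_class (pushY f))); split => //= i; by rewrite ffunE.
- move=> [a b].
  have hf i : exists f : based_map R n.+1 (w.1 (enum_val i)),
      a i = e i (homotopy_class f).
    have [g gK Kg] := eP i; have [f fE] := homotopy_class_surj (g (a i)).
    by exists f; rewrite -fE Kg.
  have [f fP] := dep_choice hf.
  have [g gP] : exists g : based_map R n.+1 w.2, b = eY (homotopy_class g).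
    have [e' eK Ke] := eYP; have [g gE] := homotopy_class_surj (e' b).
    by exists g; rewrite -gE Ke.
  pose F t : W := (fun k => f (enum_rank k) t, g t).
  have cF : {within cube n.+1, continuous F}.
    apply: wreath_space_within; last exact: based_continuous.
    by move=> k; exact: based_continuous.
  have bF t : cube_boundary t -> F t = w.
    move=> bt; rewrite /F based_boundary //.
    rewrite (_ : (fun k => _) = w.1); first by case: (w).
    by apply/funext => k; rewrite based_boundary // enum_rankK.
  exists (BasedMap cF bF); split => /= [i|].
    rewrite fP; congr (e i _); apply/homotopy_classP/homotopic_eq => t ct /=.
    by rewrite enum_valK.
  by rewrite gP; congr (eY _); apply/homotopy_classP/homotopic_eq.
- move=> f g [a b] [a' b'] [/= aE ->] [/= a'E ->]; split.
    move=> fg; congr (_, _).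
      apply/ffunP => i; rewrite aE a'E; congr (e i _).
      by apply/homotopy_classP; exact: push_homotopic.
    by congr (eY _); apply/homotopy_classP; exact: push_homotopic.
  move=> [aa' /(bij_inj eYP)/homotopy_classP hY].
  have hX i : homotopic (pushX i f) (pushX i g).
    by apply/homotopy_classP/(bij_inj (eP i)); rewrite -aE -a'E aa'.
  have [L LP] := choice hX; have [M [cM M0 M1 Mb]] := hY.
  exists (fun z => (fun k => L (enum_rank k) z, M z)); split.
  + by apply: wreath_space_within => // k; case: (LP (enum_rank k)).
  + move=> t ct; rewrite M0 //= (_ : (fun k => _) = (f t).1); first by case: (f t).
    by apply/funext => k; case: (LP (enum_rank k)) => _ -> //= _ _;
      rewrite enum_rankK.
  + move=> t ct; rewrite M1 //= (_ : (fun k => _) = (g t).1); first by case: (g t).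
    by apply/funext => k; case: (LP (enum_rank k)) => _ _ -> //= _;
      rewrite enum_rankK.
  + move=> s t sI bt; rewrite Mb //= (_ : (fun k => _) = w.1); first by case: (w).
    by apply/funext => k; case: (LP (enum_rank k)) => _ _ _ -> //=;
      rewrite enum_rankK.
- move=> f g [a b] [a' b'] [/= aE ->] [/= a'E ->]; split => [i|] /=.
    rewrite ffunE aE a'E -gmulfM; congr (e i _).
    apply: etrans (homotopy_mulE _ _) _.
    by apply/homotopy_classP/homotopic_eq => t ct; rewrite push_concat.
  rewrite -gmulfM; congr (eY _).
  apply: etrans (homotopy_mulE _ _) _.
  by apply/homotopy_classP/homotopic_eq => t ct; rewrite push_concat.
Qed.

End wreath.

Theorem theorem1p1 (R : realType) (X Y : topologicalType)
    (G : groupType) (H : finGroupType) (m : nat)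
    (aG : left_action G X) (aH : left_action H Y) :
  #|H| = m ->
  path_connected R X -> path_connected R Y ->
  properly_discontinuous aG -> properly_discontinuous aH ->
  let aW := wreath_action aG aH in
  [/\ free_action aW,
      regular_covering (orbit_map aW) &
      forall (x : X) (y : Y) (w : wreath_space H X Y),
        (exists2 d : UMagmaMorphism.type
                       (homotopy_group R 1 (orbit_map aH y)) H,
           is_boundary d &
           group_isomorphic
             (homotopy_group R 1 (orbit_map aW w))
             (wreath_product (homotopy_group R 1 (orbit_map aG x)) d)) /\
        (forall k : nat,
           group_isomorphic
             (homotopy_group R k.+2 (orbit_map aW w))
             (homotopy_group R k.+2 w) /\
           group_isomorphic
             (homotopy_group R k.+2 w)
             ({ffun 'I_m -> homotopy_group R k.+2 x} *
              homotopy_group R k.+2 y)%type)].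
Proof.
move=> <- pX pY pdG pdH aW.
have wa : wandering aW.
  by apply: wreath_wandering; exact: properly_discontinuous_wandering.
have covW : covering (orbit_map aW) by exact: wandering_covering.
split; [exact: wandering_free | exact: covering_regular |].
move=> x y w; split; last first.
  move=> k; split; first exact: covering_higher_homotopy.
  exact: homotopy_group_product.
have [d dP] := boundary_homomorphism R y pdH.1 pdH.2.
exists d => //.
pose w0 : wreath_space H X Y := (fun=> x, y).
have [c [cc c0 c1]] := wreath_path_connected pX pY w w0.
have crc : {within unit_interval, continuous (orbit_map aW \o c)}.
  by apply: continuous_comp_within cc; exact: orbit_map_continuous.
have h := fundamental_group_wreath x pdH.1 pdG.2 pdH.2 covW dP.
apply: group_isomorphic_trans h.
by apply: (@base_change R _ 0 (orbit_map aW \o c)) => //=; rewrite ?c0 ?c1.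
Qed.
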